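(* Let $\Gamma$ be a finite group and $H$ a finite-dimensional pointed Hopf algebra with coradical $\Bbbk\Gamma$, and assume there is $V\in{}^\Gamma_\Gamma\mathcal{YD}$ such that $\operatorname{gr}H=\mathfrak B(V)\#\Bbbk\Gamma$. Let $\mathcal A,\mathcal A'$ be two right $H$-simple left $H$-comodule algebras. Let $F,F'\subseteq\Gamma$ be subgroups and $\psi\in Z^2(F,\Bbbk^\times)$, $\psi'\in Z^2(F',\Bbbk^\times)$ be 2-cocycles such that $\mathcal A_0=\Bbbk_\psi F$ and $\mathcal A'_0=\Bbbk_{\psi'}F'$, and let $K,K'\subseteq\mathfrak B(V)$ be two homogeneous left coideal subalgebras such that $\operatorname{gr}\mathcal A=K\#\Bbbk_\psi F$ and $\operatorname{gr}\mathcal A'=K'\#\Bbbk_{\psi'}F'$. Then the categories ${}_{\mathcal A}\mathcal M$ and ${}_{\mathcal A'}\mathcal M$ are equivalent as module categories over $\operatorname{Rep}(H)$ if and only if there exists an element $g\in\Gamma$ such that $\mathcal A'\simeq g\mathcal Ag^{-1}$ as comodule algebras.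
   Context: $\Bbbk$ is an algebraically closed field of characteristic zero. $\mathfrak B(V)$ is the Nichols algebra of the Yetter–Drinfeld module $V$; $\mathfrak B(V)\#\Bbbk\Gamma$ its bosonization; $\operatorname{gr}H$ the graded Hopf algebra of the coradical filtration $H_0\subseteq H_1\subseteq\cdots$. For a left $H$-comodule algebra $(A,\lambda)$, the Loewy filtration is $A_n=\lambda^{-1}(H_n\otimes A)$ and $\operatorname{gr}A$ is the associated graded $\operatorname{gr}H$-comodule algebra. $A$ is right $H$-simple if it has no nontrivial right ideal $J$ with $\lambda(J)\subseteq H\otimes J$. A left coideal subalgebra $K$ of a graded Hopf algebra $U=\bigoplus U(i)$ is homogeneous if $K=\bigoplus K(i)$ is a graded algebra with $K(n)\subseteq U(n)$ and $\Delta(K(n))\subseteq\bigoplus_{i=0}^nU(i)\otimes K(n-i)$. $\Bbbk_\psi F$ is the twisted group algebra; $K\#\Bbbk_\psi F$ has product $(x\#g)(y\#f)=x(g\cdot y)\#\psi(g,f)gf$ and coaction $\lambda(x\#g)=(x_{(1)}\#g)\otimes(x_{(2)}\#g)$, where $K$ is stable under the action of $F$. For $g\in\Gamma$, $g\mathcal Ag^{-1}$ denotes the comodule algebra whose underlying algebra is $\mathcal A$, with elements written $gag^{-1}$ and product $(gag^{-1})(gbg^{-1})=g(ab)g^{-1}$, and coaction $gag^{-1}\mapsto ga_{(-1)}g^{-1}\otimes ga_{(0)}g^{-1}$. For a left $H$-comodule algebra $A$, ${}_A\mathcal M$ is the category of finite-dimensional left $A$-modules, a module category over the tensor category $\operatorname{Rep}(H)$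 of finite-dimensional $H$-modules via $V\otimes M$ with $A$ acting through the coaction. *)

(* Defs.v *)
From HB Require Import structures.
From mathcomp Require Import all_boot all_algebra all_fingroup all_field.

Set Implicit Arguments.
Unset Strict Implicit.
Unset Printing Implicit Defensive.

Import GRing.Theory.
Local Open Scope ring_scope.

(* The tensor product U (x) V is realized by coordinate matrices in the standard
   bases of U and V; its universal property is [tliftE] and [tens_ext]. *)

Section Tensor.
Variable k : fieldType.
Implicit Types U V W X Y Z : vectType k.

Definition tens U V : vectType k := 'M[k]_(\dim {:U}, \dim {:V}).

Definition tensor U V (u : U) (v : V) : tens U V :=
  \matrix_(i, j) (coord (vbasis {:U}) i u * coord (vbasis {:V}) j v).

(* The linear map U (x) V -> W induced by f; meaningful for bilinear f only. *)
Definition tlift_fun U V W (f : U -> V -> W) (t : tens U V) : W :=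
  \sum_i \sum_j t i j *: f (vbasis {:U})`_i (vbasis {:V})`_j.
Definition tlift U V W (f : U -> V -> W) : 'Hom(tens U V, W) :=
  linfun (tlift_fun f).

Definition tmap U U' V V' (f : 'Hom(U, U')) (g : 'Hom(V, V')) :
    'Hom(tens U V, tens U' V') :=
  tlift (fun u v => tensor (f u) (g v)).

Definition tassoc U V W : 'Hom(tens (tens U V) W, tens U (tens V W)) :=
  tlift (fun t w => tlift (fun u v => tensor u (tensor v w)) t).
Definition tassoc_inv U V W : 'Hom(tens U (tens V W), tens (tens U V) W) :=
  tlift (fun u t => tlift (fun v w => tensor (tensor u v) w) t).

Definition tensv U V (X : {vspace U}) (Y : {vspace V}) : {vspace tens U V} :=
  <<[seq tensor x y | x <- vbasis X, y <- vbasis Y]>>%VS.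

Definition bilin U V W (f : U -> V -> W) : Prop :=
  (forall v, linear (f^~ v)) /\ (forall u, linear (f u)).

Lemma tlift_fun_linear U V W (f : U -> V -> W) : linear (tlift_fun f).
Proof.
move=> c s t; rewrite /tlift_fun scaler_sumr -big_split /=.
apply: eq_bigr => i _; rewrite scaler_sumr -big_split /=.
by apply: eq_bigr => j _; rewrite !mxE scalerDl scalerA.
Qed.

Lemma tlift_funE U V W (f : U -> V -> W) t : tlift f t = tlift_fun f t.
Proof.
pose l := GRing.isLinear.Build _ _ _ _ _ (tlift_fun_linear f).
pose F : {linear tens U V -> W} := HB.pack (tlift_fun f) l.
exact: (lfunE F t).
Qed.

Lemma bilinDl U V W (f : U -> V -> W) :
  bilin f -> forall u u' v, f (u + u') v = f u v + f u' v.
Proof. by case=> fl _ u u' v; have := fl v 1 u u'; rewrite !scale1r. Qed.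
Lemma bilinDr U V W (f : U -> V -> W) :
  bilin f -> forall u v v', f u (v + v') = f u v + f u v'.
Proof. by case=> _ fr u v v'; have := fr u 1 v v'; rewrite !scale1r. Qed.
Lemma bilin0l U V W (f : U -> V -> W) : bilin f -> forall v, f 0 v = 0.
Proof.
by move=> bf v; apply: (addrI (f 0 v)); rewrite -bilinDl // !addr0.
Qed.
Lemma bilin0r U V W (f : U -> V -> W) : bilin f -> forall u, f u 0 = 0.
Proof.
by move=> bf u; apply: (addrI (f u 0)); rewrite -bilinDr // !addr0.
Qed.
Lemma bilinZl U V W (f : U -> V -> W) :
  bilin f -> forall c u v, f (c *: u) v = c *: f u v.
Proof.
move=> bf c u v; have := (proj1 bf) v c u 0.
by rewrite addr0 (bilin0l bf) addr0.
Qed.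
Lemma bilinZr U V W (f : U -> V -> W) :
  bilin f -> forall c u v, f u (c *: v) = c *: f u v.
Proof.
move=> bf c u v; have := (proj2 bf) u c v 0.
by rewrite addr0 (bilin0r bf) addr0.
Qed.

Lemma tliftE U V W (f : U -> V -> W) : bilin f ->
  forall u v, tlift f (tensor u v) = f u v.
Proof.
move=> bf u v; rewrite tlift_funE /tlift_fun.
rewrite {2}(coord_vbasis (memvf u)) {2}(coord_vbasis (memvf v)).
rewrite (big_morph (f^~ _) (fun x y => bilinDl bf x y _) (bilin0l bf _)).
apply: eq_bigr => i _.
rewrite (big_morph (f _) (bilinDr bf _) (bilin0r bf _)).
by apply: eq_bigr => j _; rewrite mxE (bilinZl bf) (bilinZr bf) scalerA.
Qed.

Lemma tensor_bilin U V : bilin (@tensor U V).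
Proof.
split=> [v c u u'|u c v v']; apply/matrixP=> i j; rewrite !mxE linearP.
  by rewrite mulrDl mulrA.
by rewrite mulrDr mulrCA.
Qed.

Lemma tens_ind U V (P : tens U V -> Prop) :
  P 0 -> (forall s t, P s -> P t -> P (s + t)) ->
  (forall u v, P (tensor u v)) -> forall t, P t.
Proof.
move=> P0 PD Pt t.
have -> : t = \sum_i \sum_j
    tensor (t i j *: (vbasis {:U})`_i) (vbasis {:V})`_j.
  apply/matrixP=> a b; rewrite summxE (bigD1 a) //= summxE (bigD1 b) //=.
  have cE (W : vectType k) (i j : 'I_(\dim {:W})) :
      coord (vbasis {:W}) i (vbasis {:W})`_j = (j == i)%:R.
    by rewrite coord_free ?(basis_free (vbasisP _)) // eq_sym.
  rewrite big1 ?addr0 => [|j ne]; last first.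
    by rewrite mxE linearZ /= !cE (negbTE ne) mulr0.
  rewrite big1 ?addr0 => [|i ne]; last first.
    rewrite summxE big1 // => j _.
    by rewrite mxE linearZ /= !cE (negbTE ne) mulr0 mul0r.
  by rewrite mxE linearZ /= !cE !eqxx !mulr1.
by apply: big_ind => // i _; apply: big_ind.
Qed.

Lemma tens_ext U V W (f g : 'Hom(tens U V, W)) :
  (forall u v, f (tensor u v) = g (tensor u v)) -> f = g.
Proof.
move=> fg; apply/lfunP; elim/tens_ind => // [|s t fs ft]; first by rewrite !linear0.
by rewrite !linearD /= fs ft.
Qed.

Lemma tmap_bil U U' V V' (f : 'Hom(U, U')) (g : 'Hom(V, V')) :
  bilin (fun u v => tensor (f u) (g v)).
Proof.
split=> [v c u u'|u c v v']; rewrite linearP.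
  by rewrite (bilinDl (@tensor_bilin _ _)) (bilinZl (@tensor_bilin _ _)).
by rewrite (bilinDr (@tensor_bilin _ _)) (bilinZr (@tensor_bilin _ _)).
Qed.

Lemma tmapE U U' V V' (f : 'Hom(U, U')) (g : 'Hom(V, V')) u v :
  tmap f g (tensor u v) = tensor (f u) (g v).
Proof. by rewrite /tmap (tliftE (tmap_bil f g)). Qed.

Lemma tmap_bilin U U' V V' : bilin (@tmap U U' V V').
Proof.
split=> [g c f f'|f c g g']; apply: tens_ext => u v;
  rewrite !lfun_simp !tmapE !lfun_simp.
  by rewrite (bilinDl (@tensor_bilin _ _)) (bilinZl (@tensor_bilin _ _)).
by rewrite (bilinDr (@tensor_bilin _ _)) (bilinZr (@tensor_bilin _ _)).
Qed.

Lemma tmap_id U V : tmap (\1%VF : 'End(U)) (\1%VF : 'End(V)) = \1%VF.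
Proof. by apply: tens_ext => u v; rewrite tmapE !id_lfunE. Qed.

Lemma tmap_comp U U' U'' V V' V'' (f : 'Hom(U, U')) (f' : 'Hom(U', U''))
    (g : 'Hom(V, V')) (g' : 'Hom(V', V'')) :
  tmap (f' \o f)%VF (g' \o g)%VF = (tmap f' g' \o tmap f g)%VF.
Proof. by apply: tens_ext => u v; rewrite comp_lfunE !tmapE !comp_lfunE. Qed.

Lemma tlift_bil U V W X (f : X -> U -> V -> W) :
  (forall u v, linear (fun x => f x u v)) ->
  bilin (fun t x => tlift (f x) t).
Proof.
move=> fl; split=> [x c s t|t c x y]; first by rewrite linearP.
rewrite !tlift_funE /tlift_fun scaler_sumr -big_split /=.
apply: eq_bigr => i _; rewrite scaler_sumr -big_split /=.
by apply: eq_bigr => j _; rewrite fl scalerDr !scalerA mulrC.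
Qed.

Lemma tlift_lin U V W (f g h : U -> V -> W) c :
  (forall u v, f u v = c *: g u v + h u v) ->
  forall t, tlift f t = c *: tlift g t + tlift h t.
Proof.
move=> fgh t; rewrite !tlift_funE /tlift_fun scaler_sumr -big_split /=.
apply: eq_bigr => i _; rewrite scaler_sumr -big_split /=.
by apply: eq_bigr => j _; rewrite fgh scalerDr !scalerA mulrC.
Qed.

Lemma bilinC U V W (f : U -> V -> W) : bilin f -> bilin (fun v u => f u v).
Proof. by case. Qed.

Lemma tassocE U V W (u : U) (v : V) (w : W) :
  tassoc U V W (tensor (tensor u v) w) = tensor u (tensor v w).
Proof.
rewrite /tassoc tliftE.
  apply: (@tliftE _ _ _ (fun u v => tensor u (tensor v w))); split.
    by move=> v'; apply: (proj1 (@tensor_bilin _ _)).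
  by move=> u' c x y; rewrite (proj1 (@tensor_bilin _ _)) (proj2 (@tensor_bilin _ _)).
apply: (tlift_bil (f := fun w u v => tensor u (tensor v w))) => u' v' c x y.
by rewrite (proj2 (@tensor_bilin _ _)) (proj2 (@tensor_bilin _ _)).
Qed.

Lemma tassoc_invE U V W (u : U) (v : V) (w : W) :
  tassoc_inv U V W (tensor u (tensor v w)) = tensor (tensor u v) w.
Proof.
rewrite /tassoc_inv tliftE.
  apply: (@tliftE _ _ _ (fun v w => tensor (tensor u v) w)); split.
    by move=> w' c x y; rewrite (proj2 (@tensor_bilin _ _)) (proj1 (@tensor_bilin _ _)).
  by move=> u'; apply: (proj2 (@tensor_bilin _ _)).
apply: bilinC.
apply: (tlift_bil (f := fun u v w => tensor (tensor u v) w)) => u' v' c x y.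
by rewrite (proj1 (@tensor_bilin _ _)) (proj1 (@tensor_bilin _ _)).
Qed.

Lemma tens_ext3 U V W X (f g : 'Hom(tens (tens U V) W, X)) :
  (forall u v w, f (tensor (tensor u v) w) = g (tensor (tensor u v) w)) -> f = g.
Proof.
move=> fg; apply: tens_ext; elim/tens_ind => [|s t hs ht|u v] w.
- by rewrite (bilin0l (@tensor_bilin _ _)) !linear0.
- by rewrite (bilinDl (@tensor_bilin _ _)) !linearD /= hs ht.
- exact: fg.
Qed.

Lemma tens_ext3r U V W X (f g : 'Hom(tens U (tens V W), X)) :
  (forall u v w, f (tensor u (tensor v w)) = g (tensor u (tensor v w))) -> f = g.
Proof.
move=> fg; apply: tens_ext => u; elim/tens_ind => [|s t hs ht|v w].
- by rewrite (bilin0r (@tensor_bilin _ _)) !linear0.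
- by rewrite (bilinDr (@tensor_bilin _ _)) !linearD /= hs ht.
- exact: fg.
Qed.

Lemma tens_ext4 U V W Z X (f g : 'Hom(tens (tens (tens U V) W) Z, X)) :
  (forall u v w z, f (tensor (tensor (tensor u v) w) z)
     = g (tensor (tensor (tensor u v) w) z)) -> f = g.
Proof.
move=> fg; apply: tens_ext3; elim/tens_ind => [|s t hs ht|u v] w z.
- by rewrite !(bilin0l (@tensor_bilin _ _)) !linear0.
- by rewrite !(bilinDl (@tensor_bilin _ _)) !linearD /= hs ht.
- exact: fg.
Qed.

Lemma tassocK U V W : (tassoc_inv U V W \o tassoc U V W)%VF = \1%VF.
Proof.
by apply: tens_ext3 => u v w; rewrite comp_lfunE tassocE tassoc_invE id_lfunE.
Qed.
Lemma tassoc_invK U V W : (tassoc U V W \o tassoc_inv U V W)%VF = \1%VF.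
Proof.
by apply: tens_ext3r => u v w; rewrite comp_lfunE tassoc_invE tassocE id_lfunE.
Qed.

Lemma tassoc_nat U U' V V' W W' (f : 'Hom(U, U')) (g : 'Hom(V, V'))
    (h : 'Hom(W, W')) :
  (tassoc U' V' W' \o tmap (tmap f g) h = tmap f (tmap g h) \o tassoc U V W)%VF.
Proof.
apply: tens_ext3 => u v w.
by rewrite !comp_lfunE !(tmapE, tassocE).
Qed.

(* k (x) U = U = U (x) k *)
Definition tlun U : 'Hom(tens (k^o : vectType k) U, U) :=
  tlift (fun (c : k^o) (u : U) => (c : k) *: u).
Definition trun U : 'Hom(tens U (k^o : vectType k), U) :=
  tlift (fun (u : U) (c : k^o) => (c : k) *: u).

(* The product (a (x) b)(a' (x) b') = aa' (x) bb'. *)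
Definition tmul (A B : falgType k) (s t : tens A B) : tens A B :=
  tlift (fun a b => tlift (fun a' b' => tensor (a * a') (b * b')) t) s.

Section TensorMul.
Variables A B : falgType k.

Lemma tmul_pure_bil (a : A) (b : B) :
  bilin (fun a' b' => tensor (a * a') (b * b')).
Proof.
split=> [b' c x y|a' c x y]; rewrite mulrDr -scalerAr.
  by rewrite (proj1 (@tensor_bilin _ _)).
by rewrite (proj2 (@tensor_bilin _ _)).
Qed.

Lemma tmul_bil1 (t : tens A B) :
  bilin (fun a b => tlift (fun a' b' => tensor (a * a') (b * b')) t).
Proof.
split=> [b c x y|a c x y]; apply: tlift_lin => a' b';
  rewrite mulrDl -scalerAl.
  by rewrite (proj1 (@tensor_bilin _ _)).
by rewrite (proj2 (@tensor_bilin _ _)).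
Qed.

Lemma tmul_bilin : bilin (@tmul A B).
Proof.
split=> [t c x y|s c x y]; rewrite /tmul; first by rewrite linearP.
by apply: tlift_lin => a b; rewrite linearP.
Qed.

Lemma tmulE (a a' : A) (b b' : B) :
  tmul (tensor a b) (tensor a' b') = tensor (a * a') (b * b').
Proof. by rewrite /tmul (tliftE (tmul_bil1 _)) (tliftE (tmul_pure_bil _ _)). Qed.

Lemma tens_ind2 U V U' V' (P : tens U V -> tens U' V' -> Prop) :
  (forall t, P 0 t) -> (forall s, P s 0) ->
  (forall s s' t, P s t -> P s' t -> P (s + s') t) ->
  (forall s t t', P s t -> P s t' -> P s (t + t')) ->
  (forall u v u' v', P (tensor u v) (tensor u' v')) -> forall s t, P s t.
Proof.
move=> P0l P0r PDl PDr Pt s; elim/tens_ind: s => [|s s' hs hs'|u v] t //.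
  by apply: PDl.
by elim/tens_ind: t => [|t t' ht ht'|u' v'] //; apply: PDr.
Qed.

Lemma tmul_ext W (m : W -> W -> W) (f : 'Hom(tens A B, W)) : bilin m ->
  (forall a b a' b', f (tensor (a * a') (b * b'))
      = m (f (tensor a b)) (f (tensor a' b'))) ->
  forall s t, f (tmul s t) = m (f s) (f t).
Proof.
move=> bm fE.
apply: (tens_ind2 (P := fun s t => f (tmul s t) = m (f s) (f t)))
  => [t|s|s s' t h h'|s t t' h h'|a b a' b'].
- by rewrite (bilin0l tmul_bilin) linear0 (bilin0l bm).
- by rewrite (bilin0r tmul_bilin) linear0 (bilin0r bm).
- by rewrite (bilinDl tmul_bilin) !linearD /= h h' (bilinDl bm).
- by rewrite (bilinDr tmul_bilin) !linearD /= h h' (bilinDr bm).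
- by rewrite tmulE.
Qed.

End TensorMul.

End Tensor.

Arguments tensor {k U V}.
Arguments tassoc {k U V W}.
Arguments tassoc_inv {k U V W}.

Notation "u ⊗ v" := (tensor u v) (at level 40, left associativity) : ring_scope.
Notation "f ⊠ g" := (tmap f g) (at level 40, left associativity) : ring_scope.

Record hopfAlg (k : fieldType) := HopfAlg {
  hopf_sort :> falgType k;
  hcomul : 'Hom(hopf_sort, tens hopf_sort hopf_sort);
  hcounit : 'Hom(hopf_sort, (k^o : vectType k));
  hantipode : 'End(hopf_sort);
  hcoassoc : (tassoc \o (hcomul ⊠ \1) \o hcomul = (\1 ⊠ hcomul) \o hcomul)%VF;
  hcounitl : forall x, tlift (fun a b => (hcounit a : k) *: b) (hcomul x) = x;
  hcounitr : forall x, tlift (fun a b => (hcounit b : k) *: a) (hcomul x) = x;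
  hcomul1 : hcomul 1 = 1 ⊗ 1;
  hcomulM : forall x y, hcomul (x * y) = tmul (hcomul x) (hcomul y);
  hcounit1 : hcounit 1 = 1;
  hcounitM : forall x y, hcounit (x * y) = (hcounit x : k) * hcounit y;
  hantipodel : forall x,
    tlift (fun a b => hantipode a * b) (hcomul x) = (hcounit x : k) *: 1;
  hantipoder : forall x,
    tlift (fun a b => a * hantipode b) (hcomul x) = (hcounit x : k) *: 1
}.
Arguments hcomul {k h}.
Arguments hcounit {k h}.
Arguments hantipode {k h}.

Record comodAlg (k : fieldType) (H : hopfAlg k) := ComodAlg {
  comod_sort :> falgType k;
  coact : 'Hom(comod_sort, tens H comod_sort);
  coact_assoc :
    (tassoc \o (hcomul ⊠ \1) \o coact = (\1 ⊠ coact) \o coact)%VF;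
  coact_counit : forall a,
    tlift (fun h b => (hcounit h : k) *: b) (coact a) = a;
  coact1 : coact 1 = 1 ⊗ 1;
  coactM : forall a b, coact (a * b) = tmul (coact a) (coact b)
}.
Arguments coact {k H c}.

Definition regular_comodAlg (k : fieldType) (H : hopfAlg k) : comodAlg H :=
  ComodAlg (@hcoassoc k H) (@hcounitl k H) (@hcomul1 k H) (@hcomulM k H).

Definition comodAlg_iso (k : fieldType) (H : hopfAlg k) (A B : comodAlg H) :=
  exists f : 'Hom(A, B),
    [/\ bijective f, f 1 = 1, forall a b, f (a * b) = f a * f b
      & (coact \o f = (\1 ⊠ f) \o coact)%VF].

Definition right_simple (k : fieldType) (H : hopfAlg k) (A : comodAlg H) :=
  forall J : {vspace A}, (J * fullv <= J)%VS ->
    (coact @: J <= tensv fullv J)%VS -> J = 0%VS \/ J = fullv.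

Section Coradical.
Variables (k : fieldType) (H : hopfAlg k).

Definition subcoalgebra (C : {vspace H}) := (hcomul @: C <= tensv C C)%VS.

Definition simple_subcoalgebra (C : {vspace H}) :=
  [/\ C != 0%VS, subcoalgebra C
    & forall D : {vspace H}, subcoalgebra D -> (D <= C)%VS ->
        D = 0%VS \/ D = C].

(* H0 is the sum of all simple subcoalgebras. *)
Definition is_coradical (H0 : {vspace H}) :=
  (forall C, simple_subcoalgebra C -> (C <= H0)%VS) /\
  (forall W : {vspace H},
     (forall C, simple_subcoalgebra C -> (C <= W)%VS) -> (H0 <= W)%VS).

Definition pointed := forall C, simple_subcoalgebra C -> \dim C = 1%N.

(* H_(n+1) is the wedge of H_0 and H_n. *)
Fixpoint corad_fil (H0 : {vspace H}) (n : nat) : {vspace H} :=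
  if n is m.+1 then
    (hcomul @^-1: (tensv fullv (corad_fil H0 m) + tensv H0 fullv))%VS
  else H0.

Definition loewy_fil (H0 : {vspace H}) (A : comodAlg H) (n : nat) :
    {vspace A} :=
  (coact @^-1: tensv (corad_fil H0 n) fullv)%VS.

End Coradical.

Record grouplikes (k : fieldType) (G : finGroupType) (H : hopfAlg k) :=
  Grouplikes {
  glike :> G -> H;
  glike1 : glike 1%g = 1;
  glikeM : forall x y, glike (x * y)%g = glike x * glike y;
  glike_comul : forall x, hcomul (glike x) = glike x ⊗ glike x;
  glike_counit : forall x, hcounit (glike x) = 1;
  glike_inj : injective glike
}.

Definition glspan (k : fieldType) (G : finGroupType) (H : hopfAlg k)
  (gl : grouplikes G H) : {vspace H} := <<[seq gl x | x : G]>>%VS.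

(* The comodule algebra g A g^-1: the algebra A with coaction
   a |-> g a_(-1) g^-1 (x) a_(0). *)
Section Conjugate.
Variables (k : fieldType) (G : finGroupType) (H : hopfAlg k).
Variables (gl : grouplikes G H) (A : comodAlg H) (g : G).

Definition adg : 'End(H) := (amull (gl g) \o amulr (gl g^-1%g))%VF.

Lemma adgE h : adg h = gl g * h * gl g^-1%g.
Proof. by rewrite /adg comp_lfunE !lfunE /= mulrA. Qed.

Lemma glVg : gl g^-1%g * gl g = 1.
Proof. by rewrite -glikeM mulVg glike1. Qed.
Lemma glgV : gl g * gl g^-1%g = 1.
Proof. by rewrite -glikeM mulgV glike1. Qed.

Lemma adg1 : adg 1 = 1.
Proof. by rewrite adgE mulr1 glgV. Qed.
Lemma adgM x y : adg (x * y) = adg x * adg y.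
Proof. by rewrite !adgE -!mulrA (mulrA (gl g^-1%g) (gl g)) glVg mul1r. Qed.

Lemma adg_comul : (hcomul \o adg = (adg ⊠ adg) \o hcomul)%VF.
Proof.
apply/lfunP => x; rewrite [LHS]comp_lfunE [RHS]comp_lfunE adgE !hcomulM !glike_comul.
elim/tens_ind: (hcomul x) => [|s t hs ht|a b].
- by rewrite (bilin0r (@tmul_bilin _ _ _)) (bilin0l (@tmul_bilin _ _ _)) linear0.
- rewrite (bilinDr (@tmul_bilin _ _ _)) (bilinDl (@tmul_bilin _ _ _)).
  by rewrite linearD /= hs ht.
- by rewrite !tmulE tmapE !adgE.
Qed.

Lemma adg_counit : (hcounit \o adg)%VF = hcounit.
Proof.
apply/lfunP => x; rewrite [LHS]comp_lfunE adgE !hcounitM !glike_counit.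
by rewrite mul1r mulr1.
Qed.

Definition conj_coact : 'Hom(A, tens H A) := ((adg ⊠ \1) \o coact)%VF.

Lemma conj_coact_assoc :
  (tassoc \o (hcomul ⊠ \1) \o conj_coact = (\1 ⊠ conj_coact) \o conj_coact)%VF.
Proof.
rewrite /conj_coact !comp_lfunA.
rewrite -(comp_lfunA tassoc) -tmap_comp adg_comul.
rewrite comp_lfun1l -{1}[\1%VF](comp_lfun1l \1%VF) tmap_comp comp_lfunA tassoc_nat.
rewrite -!comp_lfunA (comp_lfunA tassoc) coact_assoc !comp_lfunA -!tmap_comp.
by rewrite !comp_lfun1l !comp_lfun1r.
Qed.

Lemma conj_coact_counit a :
  tlift (fun h b => (hcounit h : k) *: b) (conj_coact a) = a.
Proof.
rewrite -[RHS]coact_counit /conj_coact comp_lfunE.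
elim/tens_ind: (coact a) => [|s t hs ht|h b]; first by rewrite !linear0.
  by rewrite !linearD /= hs ht.
have bc : bilin (fun (h : H) (b : A) => (hcounit h : k) *: b).
  split=> [c r x y|h' r x y].
    by rewrite linearP /= scalerDl !scalerA.
  by rewrite scalerDr !scalerA mulrC.
by rewrite tmapE !(tliftE bc) id_lfunE -comp_lfunE adg_counit.
Qed.

Lemma conj_coact1 : conj_coact 1 = 1 ⊗ 1.
Proof. by rewrite /conj_coact comp_lfunE coact1 tmapE adg1 id_lfunE. Qed.

Lemma conj_coactM a b : conj_coact (a * b) = tmul (conj_coact a) (conj_coact b).
Proof.
rewrite /conj_coact !comp_lfunE coactM.
apply: (tmul_ext (m := @tmul _ _ _)); first exact: tmul_bilin.
by move=> *; rewrite !tmapE !id_lfunE tmulE adgM.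
Qed.

Definition conj_comodAlg : comodAlg H :=
  ComodAlg conj_coact_assoc conj_coact_counit conj_coact1 conj_coactM.

End Conjugate.

(* A kG-comodule V is a G-graded vector space V = (+)_g V_g; the coaction is
   v |-> \sum_g g (x) ycomp g v, with ycomp g the projection onto V_g. *)
Record ydStruct (k : fieldType) (G : finGroupType) (V : vectType k) :=
  YDStruct {
  yact : G -> 'End(V);
  ycomp : G -> 'End(V);
  yact1 : yact 1%g = \1%VF;
  yactM : forall g h, yact (g * h)%g = (yact g \o yact h)%VF;
  ycomp_coassoc : forall g h v,
    ycomp g (ycomp h v) = if g == h then ycomp h v else 0;
  ycomp_counit : forall v, \sum_g ycomp g v = v;
  yd_compat : forall g h v,
    ycomp (g * h * g^-1)%g (yact g v) = yact g (ycomp h v)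
}.

(* The product of the braided tensor algebra, induced by the braiding
   c(x (x) y) = x_(-1) . y (x) x_(0):
   (a (x) b)(a' (x) b') = a (b_(-1) . a') (x) b_(0) b'. *)
Definition braided_tmul (k : fieldType) (G : finGroupType) (R : falgType k)
    (Y : ydStruct G R) (s t : tens R R) : tens R R :=
  tlift (fun a b => tlift (fun a' b' =>
    \sum_g (a * yact Y g a') ⊗ (ycomp Y g b * b')) t) s.

(* Hopf algebras in the braided category of Yetter-Drinfeld modules. *)
Record braidedHopf (k : fieldType) (G : finGroupType) := BraidedHopf {
  br_sort :> falgType k;
  br_yd : ydStruct G br_sort;
  bcomul : 'Hom(br_sort, tens br_sort br_sort);
  bcounit : 'Hom(br_sort, (k^o : vectType k));
  bantipode : 'End(br_sort);
  (* the structure maps are G-linear *)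
  b_act1 : forall g, yact br_yd g 1 = 1;
  b_actM : forall g x y,
    yact br_yd g (x * y) = yact br_yd g x * yact br_yd g y;
  b_act_comul : forall g x,
    bcomul (yact br_yd g x) = (yact br_yd g ⊠ yact br_yd g) (bcomul x);
  b_act_counit : forall g x, bcounit (yact br_yd g x) = bcounit x;
  b_act_antipode : forall g x,
    bantipode (yact br_yd g x) = yact br_yd g (bantipode x);
  (* the structure maps are G-colinear *)
  b_comp1 : ycomp br_yd 1%g 1 = 1;
  b_compM : forall h x y, ycomp br_yd h (x * y) =
    \sum_g ycomp br_yd g x * ycomp br_yd (g^-1 * h)%g y;
  b_comp_comul : forall h x, bcomul (ycomp br_yd h x) =
    \sum_g (ycomp br_yd g ⊠ ycomp br_yd (g^-1 * h)%g) (bcomul x);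
  b_comp_counit : forall h x,
    bcounit (ycomp br_yd h x) = if h == 1%g then bcounit x else 0;
  b_comp_antipode : forall h x,
    bantipode (ycomp br_yd h x) = ycomp br_yd h (bantipode x);
  (* braided Hopf algebra axioms *)
  bcoassoc : (tassoc \o (bcomul ⊠ \1) \o bcomul = (\1 ⊠ bcomul) \o bcomul)%VF;
  bcounitl : forall x, tlift (fun a b => (bcounit a : k) *: b) (bcomul x) = x;
  bcounitr : forall x, tlift (fun a b => (bcounit b : k) *: a) (bcomul x) = x;
  bcomul1 : bcomul 1 = 1 ⊗ 1;
  bcomulM : forall x y,
    bcomul (x * y) = braided_tmul br_yd (bcomul x) (bcomul y);
  bcounit1 : bcounit 1 = 1;
  bcounitM : forall x y, bcounit (x * y) = (bcounit x : k) * bcounit y;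
  bantipodel : forall x,
    tlift (fun a b => bantipode a * b) (bcomul x) = (bcounit x : k) *: 1;
  bantipoder : forall x,
    tlift (fun a b => a * bantipode b) (bcomul x) = (bcounit x : k) *: 1
}.
Arguments br_yd {k G}.
Arguments bcomul {k G b}.
Arguments bcounit {k G b}.
Arguments bantipode {k G b}.

(* V = (+)_n gr n (finite-dimensionality makes almost all gr n zero). *)
Definition grading (k : fieldType) (V : vectType k) (gr : nat -> {vspace V}) :=
  (forall N, directv (\sum_(n < N) gr n)) /\
  (exists N, (\sum_(n < N) gr n)%VS = fullv).

Record graded_braidedHopf (k : fieldType) (G : finGroupType)
    (R : braidedHopf k G) (gr : nat -> {vspace R}) : Prop := {
  gbr_grading : grading gr;
  gbr_act : forall n g, (yact (br_yd R) g @: gr n <= gr n)%VS;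
  gbr_comp : forall n g, (ycomp (br_yd R) g @: gr n <= gr n)%VS;
  gbr_1 : 1 \in gr 0%N;
  gbr_mul : forall m n, (gr m * gr n <= gr (m + n)%N)%VS;
  gbr_comul : forall n,
    (bcomul @: gr n <= \sum_(i < n.+1) tensv (gr i) (gr (n - i)%N))%VS;
  gbr_counit : forall n x, (0 < n)%N -> x \in gr n -> bcounit x = 0
}.

(* R = (+)_n gr n is a Nichols algebra of V: it is connected, generated in
   degree one, and its space of primitive elements is gr 1, which is isomorphic
   to V as a Yetter-Drinfeld module. *)
Record is_Nichols (k : fieldType) (G : finGroupType) (V : vectType k)
    (Y : ydStruct G V) (R : braidedHopf k G) (gr : nat -> {vspace R}) : Prop := {
  nichols_graded : graded_braidedHopf gr;
  nichols_0 : gr 0%N = 1%VS;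
  nichols_1 : exists f : 'Hom(V, R),
    [/\ injective f, (f @: fullv)%VS = gr 1%N,
        forall g v, f (yact Y g v) = yact (br_yd R) g (f v)
      & forall g v, f (ycomp Y g v) = ycomp (br_yd R) g (f v)];
  nichols_prim : forall x : R,
    x \in gr 1%N <-> bcomul x = x ⊗ 1 + 1 ⊗ x;
  nichols_gen : agenv (gr 1%N) = fullv
}.

Section Bosonization.
Variables (k : fieldType) (G : finGroupType) (R : braidedHopf k G).
Let Y := br_yd R.

(* The vector space R # kG: \sum_g x_g # g is the function g |-> x_g. *)
Definition smash : vectType k := {ffun G -> R}.

Definition smash_pure_fun (g : G) (x : R) : smash :=
  [ffun h => if h == g then x else 0].
(* x # g *)
Definition smash_pure (g : G) : 'Hom(R, smash) := linfun (smash_pure_fun g).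

(* The span of the x # g with x in W and g in S. *)
Definition smashv (W : {vspace R}) (S : {set G}) : {vspace smash} :=
  (\sum_(g in S) smash_pure g @: W)%VS.

(* (x # g)(y # f) = x (g . y) # psi(g, f) gf *)
Definition smash_mul (psi : G -> G -> k) (u v : smash) : smash :=
  \sum_g \sum_f psi g f *: smash_pure (g * f)%g (u g * yact Y g (v f)).

(* x # g |-> (x^(1) # (x^(2))_(-1) g) (x) ((x^(2))_(0) # g), where
   x^(1) (x) x^(2) is the braided coproduct of x. *)
Definition boson_comul_fun (u : smash) : tens smash smash :=
  \sum_g tlift (fun x y =>
    \sum_h smash_pure (h * g)%g x ⊗ smash_pure g (ycomp Y h y)) (bcomul (u g)).
Definition boson_comul : 'Hom(smash, tens smash smash) :=
  linfun boson_comul_fun.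

Lemma smash_pureE g x : smash_pure g x = smash_pure_fun g x.
Proof.
have l : linear (smash_pure_fun g).
  move=> c y z; apply/ffunP=> h; rewrite !ffunE.
  by case: eqP; rewrite // scaler0 addr0.
pose F : {linear R -> smash} :=
  HB.pack (smash_pure_fun g) (GRing.isLinear.Build _ _ _ _ _ l).
exact: (lfunE F x).
Qed.

Lemma boson_comulE u : boson_comul u = boson_comul_fun u.
Proof.
have l : linear boson_comul_fun.
  move=> c y z; rewrite /boson_comul_fun scaler_sumr -big_split.
  by apply: eq_bigr => g _; rewrite !ffunE !linearP.
pose F : {linear smash -> tens smash smash} :=
  HB.pack boson_comul_fun (GRing.isLinear.Build _ _ _ _ _ l).
exact: (lfunE F u).
Qed.

Definition boson_counit (u : smash) : k := \sum_g bcounit (u g).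

(* The grading (R # kG)(n) = R(n) # kG. *)
Definition boson_gr (gr : nat -> {vspace R}) (n : nat) : {vspace smash} :=
  smashv (gr n) [set: G].

(* K is a homogeneous left coideal subalgebra of U = R # kG contained in R, R
   being identified with R # 1. *)
Record homog_left_coideal_subalg (gr : nat -> {vspace R}) (K : {vspace R}) :
    Prop := {
  hlcs_1 : 1 \in K;
  hlcs_mul : (K * K <= K)%VS;
  hlcs_homog : exists N, K = (\sum_(n < N) (K :&: gr n))%VS;
  hlcs_comul : forall n,
    (boson_comul @: (smash_pure 1%g @: (K :&: gr n)) <=
      \sum_(i < n.+1) tensv (boson_gr gr i)
                            (smash_pure 1%g @: (K :&: gr (n - i)%N)))%VS
}.

Definition act_stable (F : {set G}) (K : {vspace R}) :=
  forall g, g \in F -> (yact Y g @: K <= K)%VS.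

End Bosonization.

(* Z^2(F, k^* ); psi is only relevant on F. *)
Definition cocycle2 (k : fieldType) (G : finGroupType) (F : {set G})
    (psi : G -> G -> k) :=
  (forall a b, a \in F -> b \in F -> psi a b != 0) /\
  (forall a b c, a \in F -> b \in F -> c \in F ->
     psi a b * psi (a * b)%g c = psi b c * psi a (b * c)%g).

Section AssociatedGraded.
Variable k : fieldType.

(* A linear isomorphism of graded spaces from (+)_n fil n / fil (n-1), with
   fil (-1) = 0, to (+)_n gr n, given by its components, the linear maps
   fil n -> gr n with kernel fil (n-1). Only the restriction of s n to fil n is
   relevant. *)
Definition gr_lin_iso (U E : vectType k) (fil : nat -> {vspace U})
    (gr : nat -> {vspace E}) (s : nat -> 'Hom(U, E)) :=
  forall n,
    (lker (s n) :&: fil n)%VS = (if n is m.+1 then fil m else 0%VS) /\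
    (s n @: fil n)%VS = gr n.

Definition gr_mul_compat (U : falgType k) (E : vectType k) (mulE : E -> E -> E)
    (fil : nat -> {vspace U}) (s : nat -> 'Hom(U, E)) :=
  forall m n a b, a \in fil m -> b \in fil n ->
    s (m + n)%N (a * b) = mulE (s m a) (s n b).

(* The coaction of gr U maps the class of a in fil n to the sum over i of the
   class of t_i in (H_i / H_(i-1)) (x) (fil (n-i) / fil (n-i-1)), for any
   decomposition of the coaction of a as a sum of t_i in H_i (x) fil (n-i). *)
Definition gr_coact_compat (H U B E : vectType k)
    (rho : 'Hom(U, tens H U)) (rhoE : 'Hom(E, tens B E))
    (filH : nat -> {vspace H}) (fil : nat -> {vspace U})
    (p : nat -> 'Hom(H, B)) (s : nat -> 'Hom(U, E)) :=
  forall n a (t : nat -> tens H U), a \in fil n ->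
    (forall i, (i <= n)%N -> t i \in tensv (filH i) (fil (n - i)%N)) ->
    rho a = \sum_(i < n.+1) t i ->
    rhoE (s n a) = \sum_(i < n.+1) (p i ⊠ s (n - i)%N) (t i).

Variables (G : finGroupType) (H : hopfAlg k) (gl : grouplikes G H).
Variables (R : braidedHopf k G) (gr : nat -> {vspace R}).
Let Hfil := corad_fil (glspan gl).
Let one2 : G -> G -> k := fun _ _ => 1.

(* p is an isomorphism gr H = R # kG of graded Hopf algebras which is the
   identity on kG. *)
Record gr_hopf_iso (p : nat -> 'Hom(H, smash R)) : Prop := {
  grH_lin : gr_lin_iso Hfil (boson_gr gr) p;
  grH_group : forall g, p 0%N (gl g) = smash_pure R g 1;
  grH_mul : gr_mul_compat (smash_mul one2) Hfil p;
  grH_comul : gr_coact_compat hcomul (boson_comul R) Hfil Hfil p p;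
  grH_counit : forall n a, a \in Hfil n ->
    boson_counit (p n a) = if n is 0%N then hcounit a else 0
}.

Variables (A : comodAlg H) (F : {group G}) (psi : G -> G -> k).
Let Afil := loewy_fil (glspan gl) A.

(* A_0 = k_psi F as a comodule algebra: e f is the basis element of k_psi F
   given by f. *)
Definition loewy0_iso := exists e : G -> A,
  [/\ basis_of (Afil 0%N) [seq e f | f in F],
      {in F &, forall f g, e f * e g = psi f g *: e (f * g)%g}
    & {in F, forall f, coact (e f) = gl f ⊗ e f}].

(* s is an isomorphism gr A = K # k_psi F of graded comodule algebras over
   gr H = R # kG. The coaction x # g |-> (x_(1) # g) (x) (x_(2) # g) is the
   restriction of the coproduct of R # kG; the unit is psi(1,1)^-1 (1 # 1). *)
Record gr_comod_iso (p : nat -> 'Hom(H, smash R)) (K : {vspace R})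
    (s : nat -> 'Hom(A, smash R)) : Prop := {
  grA_lin : gr_lin_iso Afil (fun n => smashv (K :&: gr n)%VS F) s;
  grA_1 : s 0%N 1 = smash_pure R 1%g ((psi 1%g 1%g)^-1 *: 1);
  grA_mul : gr_mul_compat (smash_mul psi) Afil s;
  grA_coact : gr_coact_compat coact (boson_comul R) Hfil Afil p s
}.

End AssociatedGraded.

Record linCat (k : fieldType) := LinCat {
  ob :> Type;
  mor : ob -> ob -> lmodType k;
  idm : forall X, mor X X;
  cmp : forall X Y Z, mor Y Z -> mor X Y -> mor X Z;
  cmp1m : forall X Y (f : mor X Y), cmp (idm Y) f = f;
  cmpm1 : forall X Y (f : mor X Y), cmp f (idm X) = f;
  cmpA : forall X Y Z W (h : mor Z W) (g : mor Y Z) (f : mor X Y),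
    cmp h (cmp g f) = cmp (cmp h g) f;
  cmp_linl : forall X Y Z (f : mor X Y), linear (fun g : mor Y Z => cmp g f);
  cmp_linr : forall X Y Z (g : mor Y Z), linear (fun f : mor X Y => cmp g f)
}.
Arguments mor {k l}.
Arguments idm {k l}.
Arguments cmp {k l X Y Z}.
Notation "g ∘ f" := (cmp g f) (at level 40, left associativity) : ring_scope.

Definition is_iso (k : fieldType) (C : linCat k) (X Y : C) (f : mor X Y) :=
  exists g : mor Y X, g ∘ f = idm X /\ f ∘ g = idm Y.

Record bifunctor (k : fieldType) (C D E : linCat k) := Bifunctor {
  bob :> C -> D -> E;
  bmor : forall X X' Y Y', mor X X' -> mor Y Y' -> mor (bob X Y) (bob X' Y');
  bmor1 : forall X Y, bmor (idm X) (idm Y) = idm (bob X Y);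
  bmor_cmp : forall X X' X'' Y Y' Y'' (f' : mor X' X'') (f : mor X X')
      (g' : mor Y' Y'') (g : mor Y Y'),
    bmor (f' ∘ f) (g' ∘ g) = bmor f' g' ∘ bmor f g;
  bmor_linl : forall X X' Y Y' (g : mor Y Y'),
    linear (fun f : mor X X' => bmor f g);
  bmor_linr : forall X X' Y Y' (f : mor X X'),
    linear (fun g : mor Y Y' => bmor f g)
}.
Arguments bmor {k C D E} _ {X X' Y Y'}.

(* Only the k-linear monoidal structure is recorded: duals play no role in the
   notions of module category and module functor. *)
Record tensorCat (k : fieldType) := TensorCat {
  tcat :> linCat k;
  tprod : bifunctor tcat tcat tcat;
  tunit : tcat;
  tass : forall X Y Z, mor (tprod (tprod X Y) Z) (tprod X (tprod Y Z));
  tlu : forall X, mor (tprod tunit X) X;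
  tru : forall X, mor (tprod X tunit) X;
  tass_iso : forall X Y Z, is_iso (tass X Y Z);
  tlu_iso : forall X, is_iso (tlu X);
  tru_iso : forall X, is_iso (tru X);
  tass_nat : forall X X' Y Y' Z Z' (f : mor X X') (g : mor Y Y') (h : mor Z Z'),
    tass X' Y' Z' ∘ bmor tprod (bmor tprod f g) h =
    bmor tprod f (bmor tprod g h) ∘ tass X Y Z;
  tlu_nat : forall X X' (f : mor X X'),
    tlu X' ∘ bmor tprod (idm tunit) f = f ∘ tlu X;
  tru_nat : forall X X' (f : mor X X'),
    tru X' ∘ bmor tprod f (idm tunit) = f ∘ tru X;
  tpentagon : forall X Y Z W,
    tass X Y (tprod Z W) ∘ tass (tprod X Y) Z W =
    bmor tprod (idm X) (tass Y Z W) ∘ tass X (tprod Y Z) W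
      ∘ bmor tprod (tass X Y Z) (idm W);
  ttriangle : forall X Y,
    bmor tprod (idm X) (tlu Y) ∘ tass X tunit Y = bmor tprod (tru X) (idm Y)
}.
Arguments tprod {k}.
Arguments tunit {k}.
Arguments tass {k}.
Arguments tlu {k}.
Arguments tru {k}.

Record moduleCat (k : fieldType) (C : tensorCat k) := ModuleCat {
  mcat :> linCat k;
  mprod : bifunctor C mcat mcat;
  mass : forall (X Y : C) (M : mcat),
    mor (mprod (tprod C X Y) M) (mprod X (mprod Y M));
  mlu : forall M : mcat, mor (mprod (tunit C) M) M;
  mass_iso : forall X Y M, is_iso (mass X Y M);
  mlu_iso : forall M, is_iso (mlu M);
  mass_nat : forall X X' Y Y' M M' (f : mor X X') (g : mor Y Y') (h : mor M M'),
    mass X' Y' M' ∘ bmor mprod (bmor (tprod C) f g) h =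
    bmor mprod f (bmor mprod g h) ∘ mass X Y M;
  mlu_nat : forall M M' (f : mor M M'),
    mlu M' ∘ bmor mprod (idm (tunit C)) f = f ∘ mlu M;
  mpentagon : forall X Y Z M,
    mass X Y (mprod Z M) ∘ mass (tprod C X Y) Z M =
    bmor mprod (idm X) (mass Y Z M) ∘ mass X (tprod C Y Z) M
      ∘ bmor mprod (tass C X Y Z) (idm M);
  mtriangle : forall X M,
    bmor mprod (idm X) (mlu M) ∘ mass X (tunit C) M =
    bmor mprod (tru C X) (idm M)
}.
Arguments mprod {k C}.
Arguments mass {k C}.
Arguments mlu {k C}.

Record functor (k : fieldType) (C D : linCat k) := Functor {
  fob :> C -> D;
  fmor : forall X Y, mor X Y -> mor (fob X) (fob Y);
  fmor1 : forall X, fmor (idm X) = idm (fob X);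
  fmor_cmp : forall X Y Z (g : mor Y Z) (f : mor X Y),
    fmor (g ∘ f) = fmor g ∘ fmor f;
  fmor_lin : forall X Y, linear (@fmor X Y)
}.
Arguments fmor {k C D} _ {X Y}.

Definition is_equivalence (k : fieldType) (C D : linCat k)
    (F : functor C D) :=
  exists (Q : functor D C)
    (eta : forall X, mor X (Q (F X))) (eps : forall Y, mor (F (Q Y)) Y),
  [/\ forall X, is_iso (eta X),
      forall X X' (f : mor X X'), eta X' ∘ f = fmor Q (fmor F f) ∘ eta X,
      forall Y, is_iso (eps Y)
    & forall Y Y' (g : mor Y Y'), eps Y' ∘ fmor F (fmor Q g) = g ∘ eps Y].

Record moduleFunctor (k : fieldType) (C : tensorCat k) (M N : moduleCat C) :=
  ModuleFunctor {
  mfun :> functor M N;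
  mfc : forall (X : C) (P : M), mor (mfun (mprod M X P)) (mprod N X (mfun P));
  mfc_iso : forall X P, is_iso (mfc X P);
  mfc_nat : forall X X' P P' (f : mor X X') (g : mor P P'),
    mfc X' P' ∘ fmor mfun (bmor (mprod M) f g) =
    bmor (mprod N) f (fmor mfun g) ∘ mfc X P;
  mfc_ass : forall X Y P,
    bmor (mprod N) (idm X) (mfc Y P) ∘ mfc X (mprod M Y P)
      ∘ fmor mfun (mass M X Y P) =
    mass N X Y (mfun P) ∘ mfc (tprod C X Y) P;
  mfc_unit : forall P,
    mlu N (mfun P) ∘ mfc (tunit C) P = fmor mfun (mlu M P)
}.

Definition module_equivalent (k : fieldType) (C : tensorCat k)
    (M N : moduleCat C) :=
  exists F : moduleFunctor M N, is_equivalence F.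

Record amod (k : fieldType) (A : falgType k) := AMod {
  amod_sort :> vectType k;
  aact : 'Hom(A, 'End(amod_sort));
  aact1 : aact 1 = \1%VF;
  aactM : forall a b, aact (a * b) = (aact a \o aact b)%VF
}.
Arguments aact {k A}.

Section ModuleMorphisms.
Variables (k : fieldType) (A : falgType k).
Implicit Types M N P : amod A.

Definition amod_hom_def M N (f : 'Hom(M, N)) : 'Hom(A, 'Hom(M, N)) :=
  linfun (fun a => (f \o aact M a) - (aact N a \o f))%VF.

(* A subspace, so that the A-linear maps inherit a k-linear structure; its
   members are characterized by [amod_homP]. *)
Definition amod_hom M N : {vspace 'Hom(M, N)} :=
  lker (linfun (@amod_hom_def M N)).

Lemma amod_hom_defE M N (f : 'Hom(M, N)) a :
  amod_hom_def f a = ((f \o aact M a) - (aact N a \o f))%VF.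
Proof.
have l : linear (fun a => (f \o aact M a) - (aact N a \o f))%VF.
  move=> c x y; rewrite !linearP /= comp_lfunDr comp_lfunDl.
  rewrite -comp_lfunZr -comp_lfunZl opprD scalerBr.
  by rewrite addrACA.
pose F : {linear A -> 'Hom(M, N)} :=
  HB.pack (fun a => (f \o aact M a) - (aact N a \o f))%VF
    (GRing.isLinear.Build _ _ _ _ _ l).
exact: (lfunE F a).
Qed.

Lemma amod_homP M N (f : 'Hom(M, N)) :
  f \in amod_hom M N <-> forall a, (f \o aact M a = aact N a \o f)%VF.
Proof.
have l : linear (@amod_hom_def M N).
  move=> c x y; apply/lfunP => a; rewrite !lfun_simp !amod_hom_defE.
  rewrite comp_lfunDr comp_lfunDl -comp_lfunZr -comp_lfunZl opprD scalerBr.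
  by rewrite addrACA.
pose F : {linear 'Hom(M, N) -> 'Hom(A, 'Hom(M, N))} :=
  HB.pack (@amod_hom_def M N) (GRing.isLinear.Build _ _ _ _ _ l).
have E : linfun (@amod_hom_def M N) f = amod_hom_def f by exact: (lfunE F f).
rewrite memv_ker E; split=> [/eqP h a|h].
  by apply/eqP; rewrite -subr_eq0 -amod_hom_defE h zero_lfunE.
by apply/eqP/lfunP => a; rewrite amod_hom_defE h subrr zero_lfunE.
Qed.

Definition amor M N : lmodType k := subvs_of (amod_hom M N).

Definition mk_amor M N (f : 'Hom(M, N))
  (h : forall a, (f \o aact M a = aact N a \o f)%VF) : amor M N :=
  Subvs (proj2 (amod_homP f) h).

Lemma amorP M N (f : amor M N) a :
  (vsval f \o aact M a = aact N a \o vsval f)%VF.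
Proof. exact: (proj1 (amod_homP (vsval f)) (subvsP f)). Qed.

Lemma amor_inj M N (f g : amor M N) : vsval f = vsval g -> f = g.
Proof. exact: val_inj. Qed.

Lemma amor_id_proof M a : (\1 \o aact M a = aact M a \o \1)%VF.
Proof. by rewrite comp_lfun1l comp_lfun1r. Qed.
Definition amor_id M : amor M M := mk_amor (@amor_id_proof M).

Lemma amor_cmp_proof M N P (g : amor N P) (f : amor M N) a :
  ((vsval g \o vsval f) \o aact M a = aact P a \o (vsval g \o vsval f))%VF.
Proof. by rewrite -comp_lfunA amorP comp_lfunA amorP comp_lfunA. Qed.
Definition amor_cmp M N P (g : amor N P) (f : amor M N) : amor M P :=
  mk_amor (amor_cmp_proof g f).

Lemma amor_cmp1m M N (f : amor M N) : amor_cmp (amor_id N) f = f.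
Proof. by apply: amor_inj; rewrite /= comp_lfun1l. Qed.
Lemma amor_cmpm1 M N (f : amor M N) : amor_cmp f (amor_id M) = f.
Proof. by apply: amor_inj; rewrite /= comp_lfun1r. Qed.
Lemma amor_cmpA M N P Q (h : amor P Q) (g : amor N P) (f : amor M N) :
  amor_cmp h (amor_cmp g f) = amor_cmp (amor_cmp h g) f.
Proof. by apply: amor_inj; rewrite /= comp_lfunA. Qed.
Lemma amor_cmp_linl M N P (f : amor M N) :
  linear (fun g : amor N P => amor_cmp g f).
Proof.
move=> c x y; apply: amor_inj.
by rewrite /= comp_lfunDl comp_lfunZl.
Qed.
Lemma amor_cmp_linr M N P (g : amor N P) :
  linear (fun f : amor M N => amor_cmp g f).
Proof.
move=> c x y; apply: amor_inj.
by rewrite /= comp_lfunDr comp_lfunZr.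
Qed.

Definition amodCat : linCat k :=
  LinCat amor_cmp1m amor_cmpm1 amor_cmpA amor_cmp_linl amor_cmp_linr.

End ModuleMorphisms.

Section ModuleAction.
Variables (k : fieldType) (H : hopfAlg k).

(* V (x) M, on which A acts through its coaction. *)
Section Tensor.
Variable A : comodAlg H.

Definition ptens (X : amod H) (M : amod A) :
    'Hom(tens H A, 'End(tens X M)) :=
  tlift (fun h a => aact X h ⊠ aact M a).

Lemma ptensE (X : amod H) (M : amod A) h a :
  ptens X M (h ⊗ a) = aact X h ⊠ aact M a.
Proof.
rewrite /ptens (tliftE (f := fun h a => aact X h ⊠ aact M a)) //.
by split=> [v c x y|u c x y]; rewrite linearP /=;
  [rewrite (proj1 (@tmap_bilin _ _ _ _ _))|rewrite (proj2 (@tmap_bilin _ _ _ _ _))].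
Qed.

Definition atens_act (X : amod H) (M : amod A) : 'Hom(A, 'End(tens X M)) :=
  (ptens X M \o coact)%VF.

Lemma atens_act1 X M : atens_act X M 1 = \1%VF.
Proof. by rewrite /atens_act comp_lfunE coact1 ptensE !aact1 tmap_id. Qed.

Lemma comp_bilin (U V W : vectType k) :
  bilin (fun (g : 'Hom(V, W)) (f : 'Hom(U, V)) => (g \o f)%VF).
Proof.
split=> [f c x y|g c x y].
  by rewrite comp_lfunDl comp_lfunZl.
by rewrite comp_lfunDr comp_lfunZr.
Qed.

Lemma atens_actM X M a b :
  atens_act X M (a * b) = (atens_act X M a \o atens_act X M b)%VF.
Proof.
have E c : atens_act X M c = ptens X M (coact c) by rewrite comp_lfunE.
rewrite !E coactM; apply: (tmul_ext (comp_bilin _ _ _)) => *.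
by rewrite !ptensE !aactM tmap_comp.
Qed.

Definition atens (X : amod H) (M : amod A) : amod A :=
  AMod (@atens_act1 X M) (@atens_actM X M).

Lemma atens_actE X M a : aact (atens X M) a = ptens X M (coact a).
Proof. exact: comp_lfunE. Qed.

Lemma atens_mor_proof X X' M M' (f : amor X X') (g : amor M M') a :
  ((vsval f ⊠ vsval g) \o aact (atens X M) a =
   aact (atens X' M') a \o (vsval f ⊠ vsval g))%VF.
Proof.
rewrite /= /atens_act !comp_lfunE.
elim/tens_ind: (coact a) => [|s t hs ht|h b].
- by rewrite !linear0 comp_lfun0l comp_lfun0r.
- by rewrite !linearD /= comp_lfunDl comp_lfunDr hs ht.
- by rewrite !ptensE -!tmap_comp !amorP.
Qed.

Definition atens_mor X X' M M' (f : amor X X') (g : amor M M') :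
    amor (atens X M) (atens X' M') :=
  @mk_amor k A (atens X M) (atens X' M') (vsval f ⊠ vsval g)
    (atens_mor_proof f g).

Lemma atens_mor1 X M : atens_mor (amor_id X) (amor_id M) = amor_id (atens X M).
Proof. by apply: amor_inj; rewrite /= tmap_id. Qed.

Lemma atens_mor_cmp X X' X'' M M' M'' (f' : amor X' X'') (f : amor X X')
    (g' : amor M' M'') (g : amor M M') :
  atens_mor (amor_cmp f' f) (amor_cmp g' g) =
  amor_cmp (atens_mor f' g') (atens_mor f g).
Proof. by apply: amor_inj; rewrite /= tmap_comp. Qed.

Lemma atens_mor_linl X X' M M' (g : amor M M') :
  linear (fun f : amor X X' => atens_mor f g).
Proof.
move=> c x y; apply: amor_inj.
by rewrite /= (proj1 (@tmap_bilin _ _ _ _ _)).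
Qed.
Lemma atens_mor_linr X X' M M' (f : amor X X') :
  linear (fun g : amor M M' => atens_mor f g).
Proof.
move=> c x y; apply: amor_inj.
by rewrite /= (proj2 (@tmap_bilin _ _ _ _ _)).
Qed.

Definition atens_bifun : bifunctor (amodCat H) (amodCat A) (amodCat A) :=
  @Bifunctor k (amodCat H) (amodCat A) (amodCat A) atens atens_mor
    atens_mor1 atens_mor_cmp atens_mor_linl atens_mor_linr.

End Tensor.

Definition rtens (X Y : amod H) : amod H :=
  @atens (regular_comodAlg H) X Y.

Section Associator.
Variable A : comodAlg H.

Lemma amass_proof (X Y : amod H) (M : amod A) a :
  (tassoc \o aact (atens (rtens X Y) M) a =
   aact (atens X (atens Y M)) a \o tassoc)%VF.
Proof.
rewrite /= /atens_act !comp_lfunE.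
have /lfunP/(_ a) := @coact_assoc k H A; rewrite !comp_lfunE.
pose PL : 'Hom(tens (tens H H) A, 'End(tens (tens X Y) M)) :=
  tlift (fun p b => @ptens (regular_comodAlg H) X Y p ⊠ aact M b).
pose PR : 'Hom(tens H (tens H A), 'End(tens X (tens Y M))) :=
  tlift (fun h q => aact X h ⊠ ptens Y M q).
have PLE p b : PL (p ⊗ b) = @ptens (regular_comodAlg H) X Y p ⊠ aact M b.
  rewrite /PL (tliftE (f := fun p b => _ p ⊠ aact M b)) //.
  by split=> [v c x y|u c x y]; rewrite linearP /=;
    [rewrite (proj1 (@tmap_bilin _ _ _ _ _))
    |rewrite (proj2 (@tmap_bilin _ _ _ _ _))].
have PRE h q : PR (h ⊗ q) = aact X h ⊠ ptens Y M q.
  rewrite /PR (tliftE (f := fun h q => aact X h ⊠ ptens Y M q)) //.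
  by split=> [v c x y|u c x y]; rewrite linearP /=;
    [rewrite (proj1 (@tmap_bilin _ _ _ _ _))
    |rewrite (proj2 (@tmap_bilin _ _ _ _ _))].
have EL t : ptens (rtens X Y) M t = PL ((hcomul ⊠ \1)%VF t).
  elim/tens_ind: t => [|s t hs ht|h b]; first by rewrite !linear0.
    by rewrite !linearD /= hs ht.
  by rewrite ptensE tmapE PLE id_lfunE /= /atens_act comp_lfunE.
have ER t : ptens X (atens Y M) t = PR ((\1 ⊠ coact)%VF t).
  elim/tens_ind: t => [|s t hs ht|h b]; first by rewrite !linear0.
    by rewrite !linearD /= hs ht.
  by rewrite ptensE tmapE PRE id_lfunE /= /atens_act comp_lfunE.
have E t : (tassoc \o PL t = PR (tassoc t) \o tassoc)%VF.
  elim/tens_ind: t => [|s t hs ht|p b].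
  - by rewrite !linear0 comp_lfun0l comp_lfun0r.
  - by rewrite !linearD /= comp_lfunDl comp_lfunDr hs ht.
  elim/tens_ind: p => [|s t hs ht|h h'].
  - by rewrite (bilin0l (@tensor_bilin _ _ _)) !linear0 comp_lfun0l comp_lfun0r.
  - rewrite (bilinDl (@tensor_bilin _ _ _)) !linearD /=.
    by rewrite comp_lfunDl comp_lfunDr hs ht.
  - by rewrite tassocE PLE PRE !ptensE tassoc_nat.
by move=> ca; rewrite EL ER E ca.
Qed.

Definition amass (X Y : amod H) (M : amod A) :
    amor (atens (rtens X Y) M) (atens X (atens Y M)) :=
  @mk_amor k A (atens (rtens X Y) M) (atens X (atens Y M)) tassoc
    (amass_proof X Y M).

Lemma amass_inv_proof (X Y : amod H) (M : amod A) a :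
  (tassoc_inv \o aact (atens X (atens Y M)) a =
   aact (atens (rtens X Y) M) a \o tassoc_inv)%VF.
Proof.
have := amass_proof X Y M a.
move/(congr1 (fun f => tassoc_inv \o f \o tassoc_inv)%VF).
rewrite !comp_lfunA tassocK comp_lfun1l -!comp_lfunA tassoc_invK comp_lfun1r.
by move=> <-.
Qed.

Lemma amass_iso (X Y : amod H) (M : amod A) :
  @is_iso k (amodCat A) _ _ (amass X Y M).
Proof.
exists (@mk_amor k A (atens X (atens Y M)) (atens (rtens X Y) M) tassoc_inv
    (amass_inv_proof X Y M)).
by split; apply: amor_inj; rewrite /= ?tassocK ?tassoc_invK.
Qed.

Lemma amass_nat (X X' Y Y' : amod H) (M M' : amod A)
    (f : amor X X') (g : amor Y Y') (h : amor M M') :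
  amor_cmp (amass X' Y' M')
    (atens_mor (@atens_mor (regular_comodAlg H) _ _ _ _ f g) h) =
  amor_cmp (atens_mor f (atens_mor g h)) (amass X Y M).
Proof. by apply: amor_inj; rewrite /= tassoc_nat. Qed.

End Associator.
(* The trivial module k, on which H acts through its counit. *)
Definition triv_act : 'Hom(H, 'End(k^o : vectType k)) :=
  linfun (fun h => (hcounit h : k) *: (\1%VF : 'End(k^o : vectType k))).

Lemma triv_actE h : triv_act h = (hcounit h : k) *: \1%VF.
Proof.
have l : linear
    (fun h : H => (hcounit h : k) *: (\1%VF : 'End(k^o : vectType k))).
  by move=> c x y; rewrite linearP /= scalerDl !scalerA.
pose F : {linear H -> 'End(k^o : vectType k)} :=
  HB.pack (fun h : H => (hcounit h : k) *: (\1%VF : 'End(k^o : vectType k)))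
    (GRing.isLinear.Build _ _ _ _ _ l).
exact: (lfunE F h).
Qed.

Lemma triv_act1 : triv_act 1 = \1%VF.
Proof. by rewrite triv_actE hcounit1 scale1r. Qed.
Lemma triv_actM a b : triv_act (a * b) = (triv_act a \o triv_act b)%VF.
Proof.
by rewrite !triv_actE hcounitM -comp_lfunZl -comp_lfunZr comp_lfun1l scalerA.
Qed.
Definition triv : amod H := AMod triv_act1 triv_actM.

Section Unitor.
Variable A : comodAlg H.

Lemma tlunE (U : vectType k) (c : k^o) (u : U) : tlun U (c ⊗ u) = (c : k) *: u.
Proof.
rewrite /tlun (tliftE (f := fun (c : k^o) (u : U) => (c : k) *: u)) //.
split=> [v r x y|x r v w].
  by rewrite scalerDl -scalerA.
by rewrite scalerDr !scalerA mulrC.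
Qed.

Lemma trunE (U : vectType k) (c : k^o) (u : U) : trun U (u ⊗ c) = (c : k) *: u.
Proof.
rewrite /trun (tliftE (f := fun (u : U) (c : k^o) => (c : k) *: u)) //.
split=> [x r v w|v r x y].
  by rewrite scalerDr !scalerA mulrC.
by rewrite scalerDl -scalerA.
Qed.

Definition tlun_inv (U : vectType k) : 'Hom(U, tens (k^o : vectType k) U) :=
  linfun (tensor (1 : k^o)).
Definition trun_inv (U : vectType k) : 'Hom(U, tens U (k^o : vectType k)) :=
  linfun (fun u => tensor u (1 : k^o)).

Lemma tlun_invE (U : vectType k) (u : U) : tlun_inv U u = (1 : k^o) ⊗ u.
Proof.
pose F : {linear U -> tens (k^o : vectType k) U} :=
  HB.pack (fun u : U => (1 : k^o) ⊗ u) (GRing.isLinear.Build _ _ _ _ _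
    (proj2 (@tensor_bilin k (k^o : vectType k) U) 1)).
exact: (lfunE F u).
Qed.
Lemma trun_invE (U : vectType k) (u : U) : trun_inv U u = u ⊗ (1 : k^o).
Proof.
pose F : {linear U -> tens U (k^o : vectType k)} :=
  HB.pack (fun u : U => u ⊗ (1 : k^o)) (GRing.isLinear.Build _ _ _ _ _
    (proj1 (@tensor_bilin k U (k^o : vectType k)) 1)).
exact: (lfunE F u).
Qed.

Lemma tlunK (U : vectType k) : (tlun_inv U \o tlun U)%VF = \1%VF.
Proof.
apply: tens_ext => c u; rewrite comp_lfunE tlunE tlun_invE id_lfunE.
rewrite (bilinZr (@tensor_bilin _ _ _)) -(bilinZl (@tensor_bilin _ _ _)).
by congr (_ ⊗ _); rewrite -[LHS]/(c * 1) mulr1.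
Qed.
Lemma tlun_invK (U : vectType k) : (tlun U \o tlun_inv U)%VF = \1%VF.
Proof.
by apply/lfunP => u; rewrite comp_lfunE tlun_invE tlunE scale1r id_lfunE.
Qed.
Lemma trunK (U : vectType k) : (trun_inv U \o trun U)%VF = \1%VF.
Proof.
apply: tens_ext => u c; rewrite comp_lfunE trunE trun_invE id_lfunE.
rewrite (bilinZl (@tensor_bilin _ _ _)) -(bilinZr (@tensor_bilin _ _ _)).
by congr (_ ⊗ _); rewrite -[LHS]/(c * 1) mulr1.
Qed.
Lemma trun_invK (U : vectType k) : (trun U \o trun_inv U)%VF = \1%VF.
Proof.
by apply/lfunP => u; rewrite comp_lfunE trun_invE trunE scale1r id_lfunE.
Qed.

Lemma intertwine_inv (B : falgType k) (M N : amod B) (f : 'Hom(M, N))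
    (g : 'Hom(N, M)) :
  (f \o g)%VF = \1%VF -> (g \o f)%VF = \1%VF ->
  (forall a, (f \o aact M a = aact N a \o f)%VF) ->
  forall a, (g \o aact N a = aact M a \o g)%VF.
Proof.
move=> fg gf h a; have := congr1 (fun u => g \o u \o g)%VF (h a).
by rewrite !comp_lfunA gf comp_lfun1l -!comp_lfunA fg comp_lfun1r => ->.
Qed.

Lemma amlu_proof (M : amod A) a :
  (tlun M \o aact (atens triv M) a = aact M a \o tlun M)%VF.
Proof.
rewrite atens_actE -[in RHS](coact_counit a).
elim/tens_ind: (coact a) => [|s t hs ht|h b].
- by rewrite !linear0 comp_lfun0l comp_lfun0r.
- by rewrite !linearD /= comp_lfunDl comp_lfunDr hs ht.
rewrite ptensE (tliftE (f := fun h (b : A) => (hcounit h : k) *: b)); last first.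
  split=> [c r x y|h' r x y].
    by rewrite linearP /= scalerDl !scalerA.
  by rewrite scalerDr !scalerA mulrC.
apply: tens_ext => c m; rewrite !comp_lfunE tmapE triv_actE !tlunE.
by rewrite scale_lfunE id_lfunE !linearZ /= scale_lfunE !scalerA mulrC.
Qed.

Definition amlu (M : amod A) : amor (atens triv M) M :=
  @mk_amor k A (atens triv M) M (tlun M) (amlu_proof M).

Lemma amlu_iso (M : amod A) : @is_iso k (amodCat A) _ _ (amlu M).
Proof.
exists (@mk_amor k A M (atens triv M) (tlun_inv M)
  (@intertwine_inv A (atens triv M) M (tlun M) (tlun_inv M) (tlun_invK M) (tlunK M) (amlu_proof M))).
by split; apply: amor_inj; rewrite /= ?tlunK ?tlun_invK.
Qed.

Lemma amlu_nat (M M' : amod A) (f : amor M M') :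
  amor_cmp (amlu M') (atens_mor (amor_id triv) f) = amor_cmp f (amlu M).
Proof.
apply: amor_inj; apply: tens_ext => c m.
by rewrite /= !comp_lfunE tmapE !tlunE id_lfunE linearZ.
Qed.

End Unitor.

Lemma amru_proof (X : amod H) a :
  (trun X \o aact (rtens X triv) a = aact X a \o trun X)%VF.
Proof.
rewrite (@atens_actE (regular_comodAlg H)) -[in RHS](hcounitr a).
change (@coact k H (regular_comodAlg H) a) with (hcomul a).
elim/tens_ind: (hcomul a) => [|s t hs ht|h b].
- by rewrite !linear0 comp_lfun0l comp_lfun0r.
- by rewrite !linearD /= comp_lfunDl comp_lfunDr hs ht.
rewrite (@ptensE (regular_comodAlg H)) (tliftE (f := fun h b => (hcounit b : k) *: h)); last first.
  split=> [h' r x y|c r x y].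
    by rewrite scalerDr !scalerA mulrC.
  by rewrite linearP /= scalerDl !scalerA.
apply: tens_ext => m c; rewrite !comp_lfunE tmapE triv_actE !trunE.
by rewrite scale_lfunE id_lfunE !linearZ /= scale_lfunE !scalerA mulrC.
Qed.

Definition amru (X : amod H) : amor (rtens X triv) X :=
  @mk_amor k H (rtens X triv) X (trun X) (amru_proof X).

Lemma amru_iso (X : amod H) : @is_iso k (amodCat H) _ _ (amru X).
Proof.
exists (@mk_amor k H X (rtens X triv) (trun_inv X)
  (@intertwine_inv H (rtens X triv) X (trun X) (trun_inv X) (trun_invK X) (trunK X) (amru_proof X))).
by split; apply: amor_inj; rewrite /= ?trunK ?trun_invK.
Qed.

Lemma amru_nat (X X' : amod H) (f : amor X X') :
  amor_cmp (amru X') (@atens_mor (regular_comodAlg H) _ _ _ _ f (amor_id triv)) =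
  amor_cmp f (amru X).
Proof.
apply: amor_inj; apply: tens_ext => m c.
by rewrite /= !comp_lfunE tmapE !trunE id_lfunE linearZ.
Qed.

Section Coherence.
Variable A : comodAlg H.

Lemma am_pentagon (X Y Z : amod H) (M : amod A) :
  amor_cmp (amass X Y (atens Z M)) (amass (rtens X Y) Z M) =
  amor_cmp
    (amor_cmp (atens_mor (amor_id X) (amass Y Z M)) (amass X (rtens Y Z) M))
    (atens_mor (@amass (regular_comodAlg H) X Y Z) (amor_id M)).
Proof.
apply: amor_inj; apply: tens_ext4 => x y z m.
by rewrite /= !comp_lfunE !(tmapE, tassocE, id_lfunE).
Qed.

Lemma am_triangle (X : amod H) (M : amod A) :
  amor_cmp (atens_mor (amor_id X) (amlu M)) (amass X triv M) =
  atens_mor (amru X) (amor_id M).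
Proof.
apply: amor_inj; apply: tens_ext3 => x c m.
rewrite /= !comp_lfunE !(tmapE, tassocE, id_lfunE) tlunE trunE.
by rewrite (bilinZr (@tensor_bilin _ _ _)) (bilinZl (@tensor_bilin _ _ _)).
Qed.

End Coherence.

Definition Rep : tensorCat k :=
  @TensorCat k (amodCat H) (@atens_bifun (regular_comodAlg H)) triv
    (@amass (regular_comodAlg H)) (@amlu (regular_comodAlg H)) amru
    (@amass_iso (regular_comodAlg H)) (@amlu_iso (regular_comodAlg H)) amru_iso
    (@amass_nat (regular_comodAlg H)) (@amlu_nat (regular_comodAlg H)) amru_nat
    (@am_pentagon (regular_comodAlg H)) (@am_triangle (regular_comodAlg H)).

Definition modRep (A : comodAlg H) : moduleCat Rep :=
  @ModuleCat k Rep (amodCat A) (@atens_bifun A)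
    (@amass A) (@amlu A) (@amass_iso A) (@amlu_iso A)
    (@amass_nat A) (@amlu_nat A) (@am_pentagon A) (@am_triangle A).

End ModuleAction.

(* Main.v *)
Require Import Defs.
From HB Require Import structures.
From mathcomp Require Import all_boot all_algebra all_fingroup all_field.
From Stdlib Require Import Classical.

(* If M |-> F(M) is an equivalence, let P = F(A), a left A'-module on which A
   acts on the right by applying F to the right multiplications of A; applying
   F to the coaction A -> H (x) A makes P an H-comodule, and A = End_{A'}(P)^op.
   H being pointed, P contains a nonzero x with coaction g (x) x. The maps
   a |-> x a and b |-> b x are injective because A is right H-simple and A' is
   left H-simple (A'_0 is a twisted group algebra). If A' x were not P, let W be
   a maximal proper sub-object containing A' x and y outside W homogeneous
   modulo W; then P = W (+) A' y with A' y free, and the A'-linear map killing W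
   and sending y to x would be right multiplication by some a with x a = 0,
   whence a = 0, a contradiction. So x a = phi(a) x defines a bijection
   phi : A -> A', which is an isomorphism g A g^-1 -> A'.
   Conversely, restriction along such an isomorphism is a module functor with
   structure map X (x) M -> X (x) M given by the action of g on X. *)

Set Implicit Arguments.
Unset Strict Implicit.
Unset Printing Implicit Defensive.

Import GRing.Theory.
Local Open Scope ring_scope.

(** * Linear maps and extremal subspaces *)

Section Linear.
Variable k : fieldType.

Lemma linfunE (U V : vectType k) (f : U -> V) : linear f -> linfun f =1 f.
Proof.
move=> l x; pose F : {linear U -> V} :=
  HB.pack f (GRing.isLinear.Build _ _ _ _ _ l).
exact: (lfunE F x).
Qed.

Definition evf (U V : vectType k) (u : U) : 'Hom('Hom(U, V), V) :=
  linfun (fun f : 'Hom(U, V) => f u).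

Lemma evfE (U V : vectType k) (u : U) (f : 'Hom(U, V)) : evf V u f = f u.
Proof. by rewrite linfunE // => c g h; rewrite !lfun_simp. Qed.

Definition coordf (U : vectType k) (i : 'I_(\dim {:U})) : 'Hom(U, (k^o : vectType k)) :=
  linfun (coord (vbasis {:U}) i : U -> (k^o : vectType k)).

Lemma coordfE (U : vectType k) (i : 'I_(\dim {:U})) u :
  coordf i u = coord (vbasis {:U}) i u.
Proof. by rewrite linfunE // => c x y; rewrite linearP. Qed.

(** It stands in for the quotient map by [N]: its kernel is exactly [N], and no quotient space has
    to be formed. *)
Definition modv (U : vectType k) (N : {vspace U}) : 'End(U) := (\1 - projv N)%VF.

Lemma modv_sub (U : vectType k) (N : {vspace U}) x : x - modv N x \in N.
Proof.
by rewrite /modv !lfun_simp opprB addrCA subrr addr0 memv_proj.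
Qed.

Lemma modv_eq0 (U : vectType k) (N : {vspace U}) x : (modv N x == 0) = (x \in N).
Proof.
apply/eqP/idP => [h|h]; first by have := modv_sub N x; rewrite h subr0.
by rewrite /modv !lfun_simp projv_id // subrr.
Qed.

(** Induct on a bound for [\dim M]: either a proper subspace of [M] satisfies [Q], or [M] is itself
    minimal. The case split is classical, since [Q] is an arbitrary predicate. *)
Lemma exists_minv (U : vectType k) (Q : {vspace U} -> Prop) (M : {vspace U}) :
  Q M -> exists W, [/\ Q W, (W <= M)%VS &
    forall W', Q W' -> (W' <= W)%VS -> W' = W].
Proof.
have [n] := ubnP (\dim M); elim: n M => // n IH M; rewrite ltnS => dM QM.
have [[W [QW sW nW]]|h] := classic (exists W, [/\ Q W, (W <= M)%VS & W <> M]).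
  have [|//|X [QX sX mX]] := IH W.
    apply: leq_trans dM; rewrite ltn_neqAle dimvS // andbT.
    by apply/eqP => e; apply: nW; apply/eqP; rewrite eqEdim sW e /=.
  by exists X; split=> //; apply: subv_trans sX sW.
exists M; split=> // W QW sW; apply: NNPP => nW; apply: h.
by exists W.
Qed.

Lemma exists_maxv (U : vectType k) (Q : {vspace U} -> Prop) (M : {vspace U}) :
  Q M -> exists W, [/\ Q W, (M <= W)%VS &
    forall W', Q W' -> (W <= W')%VS -> W' = W].
Proof.
have [n] := ubnP (\dim {:U} - \dim M); elim: n M => // n IH M.
rewrite ltnS => dM QM.
have [[W [QW sW nW]]|h] := classic (exists W, [/\ Q W, (M <= W)%VS & W <> M]).
  have dW : (\dim M < \dim W)%N.
    rewrite ltn_neqAle dimvS // andbT.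
    by apply/eqP => e; apply: nW; apply/esym/eqP; rewrite eqEdim sW e /=.
  have [|//|X [QX sX mX]] := IH W.
    by apply: leq_trans dM; rewrite ltn_sub2l // (leq_trans dW) // dimvS // subvf.
  by exists X; split=> //; apply: subv_trans sX.
exists M; split=> // W QW sW; apply: NNPP => nW; apply: h.
by exists W.
Qed.

End Linear.

(** * Slice maps on tensor products *)

Section Slices.
Variable k : fieldType.
Implicit Types U V W : vectType k.
Notation "U ^*" := ('Hom(U, (k^o : vectType k))) : type_scope.

(** The slice maps a (x) id and id (x) b. All left slices together determine a tensor, and so do all
    right slices, so that identities of tensors can be checked on vectors. *)
Definition lslice U V (a : U^*) : 'Hom(tens U V, V) :=
  tlift (fun u v => (a u : k) *: v).
Definition rslice U V (b : V^*) : 'Hom(tens U V, U) :=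
  tlift (fun u v => (b v : k) *: u).

Lemma scaleL_bilin U V (a : U^*) : bilin (fun u (v : V) => (a u : k) *: v).
Proof.
split=> [v c x y|u c x y]; first by rewrite linearP /= scalerDl scalerA.
by rewrite scalerDr !scalerA mulrC.
Qed.

Lemma lsliceE U V (a : U^*) u (v : V) : lslice V a (u ⊗ v) = (a u : k) *: v.
Proof. by rewrite /lslice (tliftE (scaleL_bilin V a)). Qed.

Lemma rsliceE U V (b : V^*) (u : U) v : rslice U b (u ⊗ v) = (b v : k) *: u.
Proof.
by rewrite /rslice (tliftE (f := fun u v => (b v : k) *: u)) //;
  apply/bilinC/scaleL_bilin.
Qed.

Lemma tensDl U V (u u' : U) (v : V) : (u + u') ⊗ v = u ⊗ v + u' ⊗ v.
Proof. exact: (bilinDl (@tensor_bilin _ _ _)). Qed.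
Lemma tensDr U V (u : U) (v v' : V) : u ⊗ (v + v') = u ⊗ v + u ⊗ v'.
Proof. exact: (bilinDr (@tensor_bilin _ _ _)). Qed.
Lemma tensZl U V c (u : U) (v : V) : (c *: u) ⊗ v = c *: (u ⊗ v).
Proof. exact: (bilinZl (@tensor_bilin _ _ _)). Qed.
Lemma tensZr U V c (u : U) (v : V) : u ⊗ (c *: v) = c *: (u ⊗ v).
Proof. exact: (bilinZr (@tensor_bilin _ _ _)). Qed.
Lemma tens0l U V (v : V) : (0 : U) ⊗ v = 0.
Proof. exact: (bilin0l (@tensor_bilin _ _ _)). Qed.
Lemma tens0r U V (u : U) : u ⊗ (0 : V) = 0.
Proof. exact: (bilin0r (@tensor_bilin _ _ _)). Qed.

Lemma lslice_decomp U V (t : tens U V) :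
  t = \sum_(i < \dim {:U}) (vbasis {:U})`_i ⊗ lslice V (coordf i) t.
Proof.
elim/tens_ind: t => [|s t hs ht|u v].
- by rewrite big1 // => i _; rewrite linear0 tens0r.
- rewrite {1}hs {1}ht -big_split; apply: eq_bigr => i _.
  by rewrite linearD tensDr.
rewrite {1}(coord_vbasis (memvf u)).
rewrite (big_morph (tensor^~ v) (fun x y => tensDl x y _) (tens0l U v)).
by apply: eq_bigr => i _; rewrite lsliceE tensZr tensZl coordfE.
Qed.

Lemma lslice_inj U V (s t : tens U V) :
  (forall a, lslice V a s = lslice V a t) -> s = t.
Proof.
move=> h; rewrite [s]lslice_decomp [t]lslice_decomp.
by apply: eq_bigr => i _; rewrite h.
Qed.

Lemma lslice_tmap U V U' V' (f : 'Hom(U, U')) (g : 'Hom(V, V')) a t :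
  lslice V' a ((f ⊠ g) t) = g (lslice V (a \o f)%VF t).
Proof.
elim/tens_ind: t => [|s t hs ht|u v]; first by rewrite !linear0.
  by rewrite !linearD /= hs ht.
by rewrite tmapE !lsliceE comp_lfunE linearZ.
Qed.

Lemma rslice_tmap U V U' V' (f : 'Hom(U, U')) (g : 'Hom(V, V')) b t :
  rslice U' b ((f ⊠ g) t) = f (rslice U (b \o g)%VF t).
Proof.
elim/tens_ind: t => [|s t hs ht|u v]; first by rewrite !linear0.
  by rewrite !linearD /= hs ht.
by rewrite tmapE !rsliceE comp_lfunE linearZ.
Qed.

Lemma tensor_mem U V (X : {vspace U}) (Y : {vspace V}) x y :
  x \in X -> y \in Y -> x ⊗ y \in tensv X Y.
Proof.
move=> /coord_vbasis -> /coord_vbasis ->.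
rewrite (big_morph (tensor^~ _) (fun x y => tensDl x y _) (tens0l U _)).
apply: memv_suml => i _; rewrite tensZl memvZ //.
rewrite (big_morph (tensor _) (fun x y => tensDr _ x y) (tens0r V _)).
apply: memv_suml => j _; rewrite tensZr memvZ //; apply: memv_span.
apply/allpairsP; exists ((vbasis X)`_i, (vbasis Y)`_j).
by rewrite !mem_nth // size_tuple.
Qed.

Lemma tensv_subv U V W (X : {vspace U}) (Y : {vspace V}) (f : 'Hom(tens U V, W))
    (Z : {vspace W}) :
  (forall x y, x \in X -> y \in Y -> f (x ⊗ y) \in Z) ->
  forall t, t \in tensv X Y -> f t \in Z.
Proof.
move=> h t ht; have: (tensv X Y <= f @^-1: Z)%VS.
  apply/span_subvP => _ /allpairsP[[x y] /= [hx hy ->]].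
  by rewrite -memv_preim h // vbasis_mem.
by move/subvP/(_ _ ht); rewrite -memv_preim.
Qed.

Lemma lslice_mem U V (X : {vspace U}) (Y : {vspace V}) a t :
  t \in tensv X Y -> lslice V a t \in Y.
Proof. by apply: tensv_subv => x y _ hy; rewrite lsliceE memvZ. Qed.

Lemma rslice_decomp U V (t : tens U V) :
  t = \sum_(j < \dim {:V}) rslice U (coordf j) t ⊗ (vbasis {:V})`_j.
Proof.
elim/tens_ind: t => [|s t hs ht|u v].
- by rewrite big1 // => i _; rewrite linear0 tens0l.
- rewrite {1}hs {1}ht -big_split; apply: eq_bigr => i _.
  by rewrite linearD tensDl.
rewrite {1}(coord_vbasis (memvf v)).
rewrite (big_morph (tensor u) (fun x y => tensDr u x y) (tens0r V u)).
by apply: eq_bigr => i _; rewrite rsliceE tensZr tensZl coordfE.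
Qed.

Lemma rslice_inj U V (s t : tens U V) :
  (forall b, rslice U b s = rslice U b t) -> s = t.
Proof.
move=> h; rewrite [s]rslice_decomp [t]rslice_decomp.
by apply: eq_bigr => i _; rewrite h.
Qed.

(** By the conditions on its slices, [t] is fixed by id (x) [projv Y] and by [projv X] (x) id, hence
    by their composite, which maps every tensor into X (x) Y. *)
Lemma mem_tensv U V (X : {vspace U}) (Y : {vspace V}) t :
  (forall a, lslice V a t \in Y) -> (forall b, rslice U b t \in X) ->
  t \in tensv X Y.
Proof.
move=> hY hX.
have tY : t = (\1 ⊠ projv Y)%VF t.
  by apply: lslice_inj => a; rewrite lslice_tmap comp_lfun1r projv_id.
have tX : t = (projv X ⊠ \1)%VF t.
  by apply: rslice_inj => b; rewrite rslice_tmap comp_lfun1r projv_id.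
rewrite tX {1}tY -comp_lfunE -tmap_comp comp_lfun1l comp_lfun1r.
elim/tens_ind: (t) => [|s s' hs hs'|u v]; first by rewrite linear0 mem0v.
  by rewrite linearD memvD.
by rewrite tmapE tensor_mem ?memv_proj.
Qed.

Lemma mem_ftensv U V (Y : {vspace V}) (t : tens U V) :
  t \in tensv fullv Y <-> forall a, lslice V a t \in Y.
Proof.
split=> [h a|h]; first exact: lslice_mem h.
by apply: mem_tensv => // b; rewrite memvf.
Qed.

Lemma rslice_comp U V W (f : 'Hom(V, W)) (b : W^*) (t : tens U V) :
  rslice U (b \o f)%VF t = rslice U b ((\1 ⊠ f) t)%VF.
Proof. by rewrite rslice_tmap id_lfunE. Qed.

Lemma lslice_rslice U V (a : U^*) (b : V^*) t :
  a (rslice U b t) = b (lslice V a t).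
Proof.
elim/tens_ind: t => [|s t hs ht|u v]; first by rewrite !linear0.
  by rewrite !linearD /= hs ht.
by rewrite rsliceE lsliceE !linearZ /= -[LHS]/(b v * a u) -[RHS]/(a u * b v) mulrC.
Qed.

End Slices.

(** * Grouplike elements in subcoalgebras of a pointed Hopf algebra *)

Section Grouplikes.
Variables (k : fieldType) (G : finGroupType) (H : hopfAlg k).
Variables (gl : grouplikes G H) (chi : G -> 'Hom(H, (k^o : vectType k))).
Hypothesis chiE : forall g h, chi g (gl h) = (g == h)%:R.

Lemma glspanE x : x \in glspan gl -> x = \sum_g (chi g x : k) *: gl g.
Proof.
move=> xs; pose f : H -> H := fun x => \sum_g (chi g x : k) *: gl g.
have fl : linear f.
  move=> c y z; rewrite /f scaler_sumr -big_split; apply: eq_bigr => g _.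
  by rewrite linearP /= scalerDl scalerA.
suff: (glspan gl <= lker (\1%VF - linfun f))%VS.
  move/subvP/(_ _ xs); rewrite memv_ker !lfun_simp linfunE // subr_eq0.
  by move/eqP.
apply/span_subvP => _ /imageP[h _ ->].
rewrite memv_ker !lfun_simp linfunE // subr_eq0 /f (bigD1 h) //= big1 => [|g gh].
  by rewrite addr0 chiE eqxx scale1r.
by rewrite chiE (negbTE gh) scale0r.
Qed.

(** Slice the coproduct of [x] by [chi g]: the form x (x) x gives chi_g(x) x, and the expansion of
    [x] in group elements gives chi_g(x) g. Some chi_g(x) is nonzero. *)
Lemma grouplike_in_glspan x :
  x != 0 -> hcomul x = x ⊗ x -> x \in glspan gl -> exists g, x = gl g.
Proof.
move=> x0 dx xs; have ex := glspanE xs.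
have [g cg] : exists g, chi g x != 0.
  apply/existsP; apply: contraNT x0; rewrite negb_exists => /forallP h.
  rewrite ex big1 // => g _; move: (h g); rewrite negbK => /eqP ->.
  by rewrite scale0r.
exists g; apply: (scalerI cg).
have <- : lslice H (chi g) (hcomul x) = (chi g x : k) *: x by rewrite dx lsliceE.
rewrite {1}ex linear_sum linear_sum (bigD1 g) //= big1 => [|h gh].
  by rewrite addr0 !linearZ /= glike_comul lsliceE chiE eqxx scale1r.
by rewrite !linearZ /= glike_comul lsliceE chiE eq_sym (negbTE gh) scale0r scaler0.
Qed.

Lemma simple_subcoalgebra_exists (D : {vspace H}) :
  subcoalgebra D -> D != 0%VS ->
  exists E, simple_subcoalgebra E /\ (E <= D)%VS.
Proof.
move=> sD D0; pose Q (E : {vspace H}) := subcoalgebra E /\ E != 0%VS.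
have [E [[sE E0] ED mE]] := @exists_minv _ _ Q D (conj sD D0).
exists E; split=> //; split=> // X sX XE.
have [->|X0] := eqVneq X 0%VS; [by left|right].
exact: mE.
Qed.

Hypotheses (H_pointed : pointed H) (H_coradical : is_coradical (glspan gl)).

(** A simple subcoalgebra of [D] is a line by pointedness and lies in the coradical. A suitable
    multiple of its generator is grouplike, hence a group element. *)
Lemma grouplike_in_subcoalgebra (D : {vspace H}) :
  subcoalgebra D -> D != 0%VS -> exists g, gl g \in D.
Proof.
move=> sD D0; have [E [simE /subvP ED]] := simple_subcoalgebra_exists sD D0.
have [E0 sE _] := simE.
have EcH := proj1 H_coradical _ simE.
pose v := vpick E; have vE : v \in E by apply: memv_pick.
have v0 : v != 0 by rewrite vpick0.
have defE : E = <[v]>%VS.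
  by apply/esym/eqP; rewrite eqEdim -memvE vE dim_vline v0 H_pointed.
have [c dv] : exists c, hcomul v = c *: (v ⊗ v).
  apply/vlineP; have: hcomul v \in tensv E E by apply: (subvP sE); apply: memv_img.
  rewrite -{2}[hcomul v]id_lfunE; apply: tensv_subv => x y.
  rewrite defE => /vlineP[a ->] /vlineP[b ->].
  by rewrite id_lfunE tensZl tensZr !memvZ // memv_line.
(* The counit recovers [v] from its coproduct, which therefore cannot vanish. *)
have c0 : c != 0.
  apply: contraNneq v0 => c0; rewrite -[v]hcounitl dv c0 scale0r.
  by rewrite linear0.
have [||//|g cv] := @grouplike_in_glspan (c *: v).
- by rewrite scaler_eq0 negb_or c0.
- by rewrite linearZ /= dv tensZl tensZr.
- by apply: (subvP EcH); rewrite memvZ.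
by exists g; rewrite -cv memvZ // ED.
Qed.
End Grouplikes.

(** * Comodules and grouplikes modulo a subcomodule *)

Section Comodules.
Variables (k : fieldType) (H : hopfAlg k) (P : vectType k).
Variable d : 'Hom(P, tens H P).
Hypothesis d_assoc : (tassoc \o (hcomul ⊠ \1) \o d = (\1 ⊠ d) \o d)%VF.
Hypothesis d_counit : forall x, lslice P hcounit (d x) = x.

Definition subcomod (N : {vspace P}) :=
  forall a x, x \in N -> lslice P a (d x) \in N.

Lemma subcomodP (N : {vspace P}) : subcomod N <-> (d @: N <= tensv fullv N)%VS.
Proof.
split=> [h|/subvP h a x xN].
  by apply/subvP => _ /memv_imgP[x xN ->]; apply/mem_ftensv => a; apply: h.
by have /mem_ftensv := h _ (memv_img d xN).
Qed.

(** The matrix coefficients x |-> x_(-1) b(x_(0)) of the comodule. *)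
Definition coeff (b : 'Hom(P, (k^o : vectType k))) : 'Hom(P, H) :=
  (rslice H b \o d)%VF.

(** This is coassociativity with [b] applied to the last factor; it makes [coeff b] a colinear map
    from P to H. *)
Lemma hcomul_coeff b x : hcomul (coeff b x) = (\1 ⊠ coeff b)%VF (d x).
Proof.
have E t : hcomul (rslice H b t) =
    (\1 ⊠ rslice H b)%VF (tassoc ((hcomul ⊠ \1)%VF t)).
  elim/tens_ind: t => [|s t hs ht|h p]; first by rewrite !linear0.
    by rewrite !linearD /= hs ht.
  rewrite rsliceE linearZ tmapE id_lfunE /=.
  elim/tens_ind: (hcomul h) => [|s t hs ht|u v].
  - by rewrite tens0l !linear0.
  - by rewrite tensDl !linearD /= hs ht.
  - by rewrite tassocE tmapE rsliceE id_lfunE tensZr.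
have /lfunP/(_ x) := d_assoc; rewrite !comp_lfunE /coeff E => ->.
by rewrite -comp_lfunE -tmap_comp comp_lfun1l.
Qed.

Lemma lslice_hcomul_coeff a b x :
  lslice H a (hcomul (coeff b x)) = coeff b (lslice P a (d x)).
Proof. by rewrite hcomul_coeff lslice_tmap comp_lfun1r. Qed.

Variables (G : finGroupType) (gl : grouplikes G H).
Hypothesis grouplike_in_sub : forall D : {vspace H},
  subcoalgebra D -> D != 0%VS -> exists g, gl g \in D.

(* Let S be minimal among the subcomodules strictly between N and M. The
   coefficient maps f_i : S -> H that kill N are colinear, and the sum of their
   images is a subcoalgebra, so contains some g. If g is in the sum of the
   images for i in J with J minimal, j in J and g = f_j s modulo the other
   images, then minimality of S forces s |-> f_j s modulo the other images to
   have kernel N, so that s is g-homogeneous modulo N. *)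
Lemma grouplike_mod (N M : {vspace P}) :
  subcomod N -> subcomod M -> (N <= M)%VS -> N <> M ->
  exists x g, [/\ x \in M, x \notin N & d x - gl g ⊗ x \in tensv fullv N].
Proof.
move=> sN sM NM nNM.
have [S [[sS NS nNS] SM minS]] := @exists_minv _ _
  (fun W => [/\ subcomod W, (N <= W)%VS & N <> W]) M (And3 sM NM nNM).
have minN W : subcomod W -> (N <= W)%VS -> (W <= S)%VS -> W <> S -> W = N.
  move=> sW NW WS nWS; apply: NNPP => nWN; apply: nWS; apply: minS => //.
  by split=> // eNW; apply: nWN.
pose f i := coeff (coordf i \o modv N)%VF.
have lsf a i x : lslice H a (hcomul (f i x)) = f i (lslice P a (d x)).
  exact: lslice_hcomul_coeff.
have fN i x : x \in N -> f i x = 0.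
  move=> xN; rewrite /f /coeff comp_lfunE rslice_comp.
  suff ->: (\1 ⊠ modv N)%VF (d x) = 0 by rewrite linear0.
  apply: lslice_inj => a; rewrite lslice_tmap comp_lfun1r linear0.
  by apply/eqP; rewrite modv_eq0 sN.
pose D (J : {set 'I_(\dim {:P})}) := (\sum_(i in J) f i @: S)%VS.
have slD J a h : h \in D J -> lslice H a (hcomul h) \in D J.
  move=> /memv_sumP[h_ hJ ->]; rewrite !linear_sum; apply: memv_suml => i iJ.
  have /memv_imgP[x xS ->] := hJ i iJ.
  rewrite /= lsf; apply: (subvP (sumv_sup i iJ (subvv _))).
  by apply: memv_img; apply: sS.
have DT_sub : subcoalgebra (D setT).
  apply/subvP => _ /memv_imgP[h hD ->]; apply: mem_tensv => b; first exact: slD.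
  case/memv_sumP: hD => h_ hD ->; rewrite !linear_sum; apply: memv_suml => i iT /=.
  have /memv_imgP[x xS ->] := hD i iT.
  have -> : hcomul (f i x) = (\1 ⊠ f i)%VF (d x) by apply: hcomul_coeff.
  (* The functional b o f_i kills [N], so it factors through [modv N]. Expanding the second factor
     in the basis of P then writes the right slice as a combination of the f_j x, with [j] ranging
     over all indices. *)
  rewrite -rslice_comp; set psi := (b \o _)%VF.
  have -> : psi = (psi \o modv N)%VF.
    apply/lfunP => y; rewrite [RHS]comp_lfunE; apply/eqP; rewrite -subr_eq0.
    rewrite -linearB [X in X == _]comp_lfunE.
    by rewrite fN ?linear0 // modv_sub.
  rewrite rslice_comp [X in rslice H psi X]rslice_decomp linear_sum.
  apply: memv_suml => j _; rewrite /= rsliceE memvZ // -rslice_comp.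
  rewrite -[rslice _ _ _](comp_lfunE (rslice H _) d) -[(_ \o d)%VF]/(f j).
  by apply: (subvP (sumv_sup j (in_setT j) (subvv _))); apply: memv_img.
(* The counit sends f_i u to the i-th coordinate of [modv N u], so the f_i cannot all vanish at a
   vector outside [N]. *)
have DT0 : D setT != 0%VS.
  have [u uS uN] : exists2 u, u \in S & u \notin N.
    apply/subvPn; apply: contra_notN nNS => SN.
    by apply/eqP; rewrite eqEsubv NS.
  apply: contraNneq uN => D0; rewrite -modv_eq0.
  rewrite (coord_vbasis (memvf (modv N u))) big1 // => i _.
  have : f i u \in D setT.
    by apply: (subvP (sumv_sup i (in_setT i) (subvv _))); apply: memv_img.
  rewrite D0 memv0 => /eqP fs0.
  have := lslice_rslice (hcounit : 'Hom(H, k^o : vectType k))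
    (coordf i \o modv N)%VF (d u).
  rewrite d_counit -[rslice _ _ _](comp_lfunE (rslice H _) d) -[(_ \o d)%VF]/(f i).
  by rewrite fs0 linear0 comp_lfunE coordfE => <-; rewrite scale0r.
have [g gD] := grouplike_in_sub DT_sub DT0.
have [J /minsetP[gJ minJ] _] := minset_exists (P := fun J => gl g \in D J) gD.
have [j jJ] : exists j, j \in J.
  apply/set0Pn; apply: contraTneq gJ => ->; rewrite /D big_set0 memv0.
  apply: contra_eqN (glike_counit gl g) => /eqP ->.
  by rewrite linear0 eq_sym oner_eq0.
have gJj : gl g \notin D (J :\ j).
  apply/negP => /minJ/(_ (subsetDl _ _)) eJ.
  by have := jJ; rewrite -eJ !inE eqxx.
have DJ : D J = (f j @: S + D (J :\ j))%VS.
  by rewrite /D (big_setD1 j jJ).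
move: gJ; rewrite DJ => /memv_addP[_ /memv_imgP[s ss ->] [h hD eg]].
set D' := D (J :\ j) in gJj hD.
pose S' := (S :&: f j @^-1: D')%VS.
have sS' : S' = N.
  apply: minN.
  - move=> a x; rewrite !memv_cap => /andP[xS]; rewrite -!memv_preim => fx.
    by rewrite sS //= -lsf slD.
  - rewrite subv_cap NS; apply/subvP => x xN.
    by rewrite -memv_preim fN // mem0v.
  - exact: capvSl.
  move=> eS; have: s \in S' by rewrite eS.
  rewrite memv_cap -memv_preim => /andP[_ fs]; case/negP: gJj.
  by rewrite eg memvD.
have sN' : s \notin N.
  rewrite -sS' memv_cap ss /= -memv_preim; apply: contraNN gJj => fs.
  by rewrite eg memvD.
exists s, g; split=> //; first exact: (subvP SM).
(* Since f_j s = g - h, the map f_j sends the a-slice of d s - g (x) s to a(g) h minus the a-slice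
   of the coproduct of h: the terms in g cancel. The result lies in [D'], so the slice lies in [S'],
   which is [N]. *)
apply/mem_ftensv => a; rewrite -sS' linearB /= lsliceE memv_cap.
rewrite memvB ?memvZ ?sS //= -memv_preim linearB /= linearZ /=.
rewrite -lsf; have -> : f j s = gl g - h by rewrite eg addrK.
rewrite linearB /= glike_comul linearB /= lsliceE scalerBr opprB addrC addrA subrK.
by rewrite memvB ?memvZ // slD.
Qed.
End Comodules.

(** * The regular module *)

Section RegularModule.
Variables (k : fieldType) (A : falgType k).

Definition areg_act : 'Hom(A, 'End(A)) := linfun (@amull k A).

Lemma areg_actE a : areg_act a = amull a.
Proof. by rewrite linfunE // => c x y; rewrite linearP. Qed.

Lemma areg_act1 : areg_act 1 = \1%VF.
Proof. by rewrite areg_actE amull1. Qed.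

Lemma areg_actM a b : areg_act (a * b) = (areg_act a \o areg_act b)%VF.
Proof. by rewrite !areg_actE amullM. Qed.

Definition areg : amod A := AMod areg_act1 areg_actM.

Lemma areg_mulE a b : aact areg a b = a * b.
Proof. by rewrite /= areg_actE lfunE. Qed.

Lemma amullE (a b : A) : amull a b = a * b.
Proof. by rewrite lfunE. Qed.

Lemma amulrE (a b : A) : amulr a b = b * a.
Proof. by rewrite lfunE. Qed.

End RegularModule.

(** * Left simplicity from the twisted group algebra in degree zero *)

Section ComoduleAlgebras.
Variables (k : fieldType) (G : finGroupType) (H : hopfAlg k).
Variable gl : grouplikes G H.
Hypothesis grouplike_in_sub : forall D : {vspace H},
  subcoalgebra D -> D != 0%VS -> exists g, gl g \in D.

(* A grouplike of A lies in A_0 = k_psi F, hence is a scalar multiple of a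
   basis element of k_psi F, hence a unit. *)
Lemma loewy0_left_simple (A : comodAlg H) (F : {group G}) (psi : G -> G -> k)
    (J : {vspace A}) :
  cocycle2 F psi -> loewy0_iso gl A F psi ->
  (forall a x, x \in J -> a * x \in J) -> subcomod (@coact k H A) J ->
  1 \notin J -> J = 0%VS.
Proof.
move=> [psi0 _] [e [be eM ce]] idJ sJ J1; apply: NNPP => nJ.
have [|//|||x [g [xJ x0 dx]]] := grouplike_mod (@coact_assoc k H A)
    (@coact_counit k H A) grouplike_in_sub (N := 0%VS) (M := J).
- by move=> a x; rewrite memv0 => /eqP ->; rewrite !linear0 mem0v.
- exact: sub0v.
- by move=> e0; apply: nJ.
have {}dx : coact x = gl g ⊗ x.
  apply: lslice_inj => a; move/mem_ftensv/(_ a): dx.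
  by rewrite memv0 linearB subr_eq0 => /eqP.
have grouplike_mem y h : coact y = gl h ⊗ y -> y \in loewy_fil (glspan gl) A 0%N.
  move=> dy; rewrite -memv_preim dy; apply: tensor_mem; last exact: memvf.
  by apply: memv_span; apply: image_f.
have grouplikeE y h : coact y = gl h ⊗ y -> y != 0 ->
    h \in F /\ exists2 c, c != 0 & y = c *: e h.
  move=> dy y0; have yA := grouplike_mem y h dy.
  pose X := in_tuple [seq e f | f in F].
  pose c i : 'Hom(A, k^o : vectType k) := linfun (coord X i : A -> k^o).
  have cE i z : c i z = coord X i z by rewrite linfunE // => ? ? ?; rewrite linearP.
  have ey : y = \sum_i coord X i y *: X`_i by apply: coord_basis yA.
  have Xi (i : 'I_(size [seq e f | f in F])) : exists2 f, f \in F & X`_i = e f.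
    by have /imageP[f fF ->] := mem_nth 0 (ltn_ord i); exists f.
  (* Slicing the coaction of [y] by its i-th coordinate functional gives c_i f = c_i h in H, where
     c_i is the i-th coordinate of [y]. *)
  have hi (i : 'I_(size [seq e f | f in F])) f :
      f \in F -> X`_i = e f -> coord X i y != 0 -> f = h.
    move=> fF Xf ci0; apply: (@glike_inj _ _ _ gl); apply: (scalerI ci0).
    have := rsliceE (c i) (gl h) y; rewrite -dy {1}ey => /esym; rewrite cE => ->.
    rewrite !linear_sum (bigD1 i) //= big1 => [|j ji].
      rewrite addr0 !linearZ /= Xf ce // rsliceE cE -Xf.
      by rewrite coord_free ?(basis_free be) // eqxx scale1r.
    have [f' f'F Xj] := Xi j.
    rewrite !linearZ /= Xj ce // rsliceE cE -Xj.
    by rewrite coord_free ?(basis_free be) // (negbTE ji) scale0r scaler0.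
  have [i ci0] : exists i, coord X i y != 0.
    apply/existsP; apply: contraNT y0; rewrite negb_exists => /forallP h0.
    rewrite ey big1 // => i _; move: (h0 i); rewrite negbK => /eqP ->.
    by rewrite scale0r.
  split; first by have [f fF Xf] := Xi i; rewrite -(hi i f).
  have ey' : y = (\sum_i coord X i y) *: e h.
    rewrite {1}ey scaler_suml; apply: eq_bigr => j _.
    have [f fF Xf] := Xi j; have [->|cj0] := eqVneq (coord X j y) 0.
      by rewrite !scale0r.
    by rewrite Xf (hi j f).
  exists (\sum_i coord X i y) => //.
  by apply: contraNneq y0 => s0; rewrite ey' s0 scale0r.
rewrite memv0 in x0; have [gF [c c0 xE]] := grouplikeE x g dx x0.
(* The unit is a multiple of e_1, not necessarily e_1 itself as psi need not be normalized. Since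
   e_(g^-1) e_g = psi(g^-1, g) e_1, a multiple of e_(g^-1) x is the unit. *)
have [] := grouplikeE 1 1%g; rewrite ?coact1 ?glike1 ?oner_neq0 // => F1 [c1 _ oneE].
have Vg : g^-1%g \in F by rewrite groupV.
case/negP: J1; have := idJ (e g^-1%g) x xJ.
rewrite xE -scalerAr eM // mulVg scalerA => /(memvZ (c1 / (c * psi g^-1%g g))).
by rewrite scalerA mulfVK ?mulf_neq0 ?psi0 // -oneE.
Qed.

End ComoduleAlgebras.

(** * An equivariant bimodule yields a conjugation isomorphism *)

Section Bimodule.
Variables (k : fieldType) (G : finGroupType) (H : hopfAlg k).
Variable gl : grouplikes G H.
Hypothesis grouplike_in_sub : forall D : {vspace H},
  subcoalgebra D -> D != 0%VS -> exists g, gl g \in D.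

Lemma ptens_coideal (B : comodAlg H) (X : amod H) (M : amod B) (W : {vspace M}) :
  (forall b x, x \in W -> aact M b x \in W) ->
  forall t s, s \in tensv fullv W -> ptens X M t s \in tensv fullv W.
Proof.
move=> hW t s sW; elim/tens_ind: t => [|t t' ht ht'|h b].
- by rewrite linear0 zero_lfunE mem0v.
- by rewrite linearD add_lfunE memvD.
rewrite ptensE; apply: (tensv_subv _ sW) => x y _ yW.
by rewrite tmapE tensor_mem ?memvf ?hW.
Qed.

Lemma ptens_tensor (B : comodAlg H) (X : amod H) (M : amod B) t x y :
  ptens X M t (x ⊗ y) = ((evf X x \o aact X) ⊠ (evf M y \o aact M))%VF t.
Proof.
elim/tens_ind: t => [|t t' ht ht'|h b].
- by rewrite !linear0 zero_lfunE.
- by rewrite !linearD add_lfunE ht ht'.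
by rewrite ptensE !tmapE !comp_lfunE !evfE.
Qed.

Variables A B : comodAlg H.
Hypothesis A_simple : right_simple A.
Hypothesis B_simple : forall J : {vspace B},
  (forall b x, x \in J -> b * x \in J) -> subcomod (@coact k H B) J ->
  1 \notin J -> J = 0%VS.
(** [P] will be a B-A-bimodule with a compatible coaction. [R] encodes the right action of A, whence
    the reversed product in [RM]; [R_full] is the surjectivity half of A = End_B(P)^op. *)
Variables (P : amod B) (d : 'Hom(P, tens H P)) (R : 'Hom(A, 'End(P))).
Hypothesis P_neq0 : exists x : P, x != 0.
Hypothesis d_assoc : (tassoc \o (hcomul ⊠ \1) \o d = (\1 ⊠ d) \o d)%VF.
Hypothesis d_counit : forall x, lslice P hcounit (d x) = x.
Hypothesis d_act : forall b x, d (aact P b x) = ptens (areg H) P (coact b) (d x).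
Hypothesis R1 : R 1 = \1%VF.
Hypothesis RM : forall a b, R (a * b) = (R b \o R a)%VF.
Hypothesis R_act : forall a b, (R a \o aact P b = aact P b \o R a)%VF.
Hypothesis d_R : forall a x,
  d (R a x) = tlift (fun h b => @amulr k H h ⊠ R b) (coact a) (d x).
Hypothesis R_full : forall f : 'End(P),
  (forall b, (f \o aact P b = aact P b \o f)%VF) -> exists a, f = R a.

Let rgen x : 'Hom(A, P) := (evf P x \o R)%VF.
Let lgen x : 'Hom(B, P) := (evf P x \o aact P)%VF.

Let rgenE x a : rgen x a = R a x.
Proof. by rewrite comp_lfunE evfE. Qed.
Let lgenE x b : lgen x b = aact P b x.
Proof. by rewrite comp_lfunE evfE. Qed.

Let ptens_gl t g x :
  ptens (areg H) P t (gl g ⊗ x) = (amulr (gl g) ⊠ lgen x)%VF t.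
Proof.
rewrite ptens_tensor; congr ((_ ⊠ _)%VF _).
by apply/lfunP => h; rewrite comp_lfunE evfE areg_mulE amulrE.
Qed.

Let lslice_ptens f t g x : lslice P f (ptens (areg H) P t (gl g ⊗ x)) =
  lgen x (lslice B (f \o amulr (gl g))%VF t).
Proof. by rewrite ptens_gl lslice_tmap. Qed.

Let d_lgen g x b : d x = gl g ⊗ x ->
  d (lgen x b) = (amulr (gl g) ⊠ lgen x)%VF (coact b).
Proof.
by move=> dx; rewrite lgenE d_act dx ptens_gl.
Qed.

Let d_rgen g x a : d x = gl g ⊗ x ->
  d (rgen x a) = (amull (gl g) ⊠ rgen x)%VF (coact a).
Proof.
move=> dx; rewrite rgenE d_R dx; elim/tens_ind: (coact a) => [|s t hs ht|h b].
- by rewrite !linear0 zero_lfunE.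
- by rewrite !linearD add_lfunE hs ht.
rewrite (tliftE (f := fun h b => amulr h ⊠ R b)); last first.
  by split=> [v c u w|u c v w]; rewrite linearP;
    [apply: (proj1 (@tmap_bilin _ _ _ _ _))
    |apply: (proj2 (@tmap_bilin _ _ _ _ _))].
by rewrite !tmapE rgenE amulrE amullE.
Qed.

(** The annihilator of [x] in A is a right ideal, and it is costable because x a has coaction g
    a_(-1) (x) x a_(0) with g invertible. It does not contain 1, so right simplicity makes it
    zero. *)
Let rgen_inj g x : d x = gl g ⊗ x -> x != 0 -> lker (rgen x) = 0%VS.
Proof.
move=> dx x0; case: (A_simple (J := lker (rgen x))) => //.
- apply/prodvP => a b; rewrite !memv_ker !rgenE RM comp_lfunE => /eqP -> _.
  by rewrite linear0.
- apply/subcomodP => f a; rewrite !memv_ker => /eqP ra.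
  pose f' := (f \o amull (gl g^-1%g))%VF.
  have := congr1 (lslice P f') (d_rgen a dx); rewrite ra !linear0 lslice_tmap.
  have -> : (f' \o amull (gl g))%VF = f.
    apply/lfunP => h; rewrite !comp_lfunE !amullE mulrA -glikeM mulVg glike1.
    by rewrite mul1r.
  by move=> <-.
move=> ef; have: (1 : A) \in lker (rgen x) by rewrite ef memvf.
by rewrite memv_ker rgenE R1 id_lfunE (negbTE x0).
Qed.

(* The b with b x in W form a costable left ideal, not containing 1. *)
Let lgen_inj g x (W : {vspace P}) :
  subcomod d W -> (forall b y, y \in W -> aact P b y \in W) ->
  d x - gl g ⊗ x \in tensv fullv W -> x \notin W ->
  forall b, aact P b x \in W -> b = 0.
Proof.
move=> sW aW dx xW b bx; pose J := (lgen x @^-1: W)%VS.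
have addW (u v : P) : u \in W -> u + v \in W -> v \in W.
  by move=> uW /memvB/(_ uW); rewrite addrAC subrr add0r.
suff J0 : J = 0%VS by apply/eqP; rewrite -memv0 -J0 -memv_preim lgenE.
apply: B_simple.
- move=> c y; rewrite -!memv_preim !lgenE aactM comp_lfunE; exact: aW.
- move=> f y; rewrite -!memv_preim !lgenE => yx.
  pose f' := (f \o amulr (gl g^-1%g))%VF.
  have [z zW dxE] : exists2 z, z \in tensv fullv W & d x = z + gl g ⊗ x.
    by exists (d x - gl g ⊗ x); rewrite ?subrK.
  (* The part of d x lying in H (x) W contributes only elements of [W], so d x may be treated as g
     (x) x. *)
  have wW : lslice P f' (ptens (areg H) P (coact y) z) \in W.
    by have := lslice_mem f' (@ptens_coideal B (areg H) P W aW (coact y) _ zW).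
  have := sW f' _ yx; rewrite d_act dxE !linearD /=.
  move=> h; have {h} := addW _ _ wW h.
  rewrite lslice_ptens lgenE.
  have -> // : (f' \o amulr (gl g))%VF = f.
  apply/lfunP => h; rewrite !comp_lfunE !amulrE -mulrA -glikeM.
  by rewrite mulgV glike1 mulr1.
by rewrite -memv_preim lgenE aact1 id_lfunE.
Qed.

Let lgen_onto g x : d x = gl g ⊗ x -> x != 0 -> limg (lgen x) = fullv.
Proof.
move=> dx x0; apply: NNPP => nfull.
pose Q (W : {vspace P}) :=
  [/\ forall b y, y \in W -> aact P b y \in W, subcomod d W & W <> fullv].
have QN : Q (limg (lgen x)).
  split=> // [b _ /memv_imgP[c _ ->]|f _ /memv_imgP[c _ ->]].
    by rewrite lgenE -comp_lfunE -aactM -lgenE memv_img ?memvf.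
  by rewrite (d_lgen _ dx) lslice_tmap memv_img ?memvf.
have [W [[aW sW nW] NW maxW]] := exists_maxv QN.
have sT : subcomod d fullv by move=> *; apply: memvf.
have [y [g' [_ yW dy]]] :=
  grouplike_mod d_assoc d_counit grouplike_in_sub sW sT (subvf _) nW.
(* W + B y is again a subobject, because the coaction of b y is b_(-1) g' (x) b_(0) y modulo H (x)
   W. It contains y, so maximality of [W] forces it to be everything. *)
have W_y : (W + limg (lgen y))%VS = fullv.
  apply: NNPP => nWy.
  have yWy : y \in (W + limg (lgen y))%VS.
    apply: (subvP (addvSr _ _)); have := memv_img (lgen y) (memvf 1).
    by rewrite lgenE aact1 id_lfunE.
  case/negP: yW; rewrite -(maxW (W + limg (lgen y))%VS) ?addvSl //; split=> //.
    move=> b _ /memv_addP[w wW [_ /memv_imgP[c _ ->] ->]].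
    rewrite linearD /= lgenE -comp_lfunE -aactM -(lgenE y).
    by apply: memv_add; [apply: aW|rewrite memv_img ?memvf].
  move=> f _ /memv_addP[w wW [_ /memv_imgP[c _ ->] ->]].
  rewrite !linearD /= memvD //.
    by apply: (subvP (addvSl _ _)); apply: sW.
  have [z zW dyE] : exists2 z, z \in tensv fullv W & d y = z + gl g' ⊗ y.
    by exists (d y - gl g' ⊗ y); rewrite ?subrK.
  rewrite lgenE d_act dyE !linearD /= memvD //.
    apply: (subvP (addvSl _ _)).
    by have := lslice_mem f (@ptens_coideal B (areg H) P W aW (coact c) _ zW).
  by apply: (subvP (addvSr _ _)); rewrite lslice_ptens memv_img ?memvf.
(* [T] is b |-> b y modulo W; once it is injective, T^-1 o [modv W] reads off b from w + b y. *)
pose T := (modv W \o lgen y)%VF.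
have T0 : lker T == 0%VS.
  rewrite -subv0; apply/subvP => b; rewrite memv_ker memv0 comp_lfunE modv_eq0.
  by rewrite lgenE => /(lgen_inj sW aW dy yW) ->.
pose f := (lgen x \o T^-1 \o modv W)%VF.
have fE w b : w \in W -> f (w + aact P b y) = aact P b x.
  move=> wW; rewrite /f 2!comp_lfunE linearD /=.
  have /eqP -> : modv W w == 0 by rewrite modv_eq0.
  by rewrite add0r -lgenE -[modv W _]comp_lfunE lker0_lfunK // lgenE.
have xW : x \in W.
  apply: (subvP NW); have := memv_img (lgen x) (memvf 1).
  by rewrite lgenE aact1 id_lfunE.
have [|a fR] := @R_full f.
  move=> b; apply/lfunP => z; rewrite [LHS]comp_lfunE [RHS]comp_lfunE.
  have: z \in (W + limg (lgen y))%VS by rewrite W_y memvf.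
  case/memv_addP=> w wW [_ /memv_imgP[c _ ->] ->].
  rewrite lgenE; have -> : aact P b (w + aact P c y) = aact P b w + aact P (b * c) y.
    by rewrite linearD aactM comp_lfunE.
  by rewrite !fE ?aW // aactM comp_lfunE.
(* As x lies in [W], the map [f] kills it, so x a = 0 and a = 0. Then [f] is zero, although it sends
   y to x. *)
have a0 : a = 0.
  apply/eqP; rewrite -memv0 -(rgen_inj dx x0) memv_ker rgenE -fR.
  by have := fE x 0 xW; rewrite !linear0 !zero_lfunE addr0 => ->.
have := fE 0 1 (mem0v W); rewrite fR a0 linear0 zero_lfunE aact1 id_lfunE.
by move=> xe; rewrite -xe eqxx in x0.
Qed.

Lemma bimodule_conj : exists g, comodAlg_iso B (conj_comodAlg gl A g).
Proof.
have s0 : subcomod d 0%VS.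
  by move=> a x; rewrite memv0 => /eqP ->; rewrite !linear0 mem0v.
have sT : subcomod d fullv by move=> *; apply: memvf.
have [|x [g [_ x0 dx]]] :=
  grouplike_mod d_assoc d_counit grouplike_in_sub s0 sT (subvf _).
  move=> e0; have [x] := P_neq0; apply/negP; rewrite negbK -memv0 e0.
  exact: memvf.
rewrite memv0 in x0.
have {}dx : d x = gl g ⊗ x.
  apply: lslice_inj => a; move/mem_ftensv/(_ a): dx.
  by rewrite memv0 linearB subr_eq0 => /eqP.
exists g; pose L := lgen x; pose Rx := rgen x.
have L0 : lker L == 0%VS.
  rewrite -subv0; apply/subvP => b; rewrite memv_ker memv0 lgenE => /eqP bx.
  apply/eqP; apply: (lgen_inj (g := g) (x := x) s0).
  - by move=> c y; rewrite memv0 => /eqP ->; rewrite linear0 mem0v.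
  - by rewrite dx subrr mem0v.
  - by rewrite memv0.
  - by rewrite bx mem0v.
have LT := lgen_onto dx x0.
have R0 : lker Rx == 0%VS by rewrite (rgen_inj dx x0).
pose phi := (L^-1 \o Rx)%VF.
have phiE a : L (phi a) = Rx a.
  by rewrite [phi a]comp_lfunE limg_lfunVK // LT memvf.
have L_inj : injective L by apply/lker0P.
pose psi := (Rx^-1 \o L)%VF.
(* Write y = b x. The B-linear endomorphism c x |-> c b x is right multiplication by some [a], and
   its value at x shows b x = x a. *)
have RT y : y \in limg Rx.
  have := memvf y; rewrite -LT => /memv_imgP[b _ ->].
  pose f := (lgen (L b) \o L^-1)%VF.
  have fE c : f (lgen x c) = aact P c (L b).
    by rewrite [f _]comp_lfunE lker0_lfunK // lgenE.
  have [|a fR] := @R_full f.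
    move=> c; apply/lfunP => z; rewrite [LHS]comp_lfunE [RHS]comp_lfunE.
    have := memvf z; rewrite -LT => /memv_imgP[e _ ->].
    have -> : aact P c (lgen x e) = lgen x (c * e).
      by rewrite !lgenE aactM comp_lfunE.
    by rewrite !fE aactM comp_lfunE.
  have := fE 1; rewrite lgenE !aact1 !id_lfunE fR => <-.
  by rewrite -rgenE memv_img ?memvf.
have psiK : cancel psi phi.
  by move=> b; apply: L_inj; rewrite phiE [psi b]comp_lfunE limg_lfunVK // RT.
have phiK : cancel phi psi.
  by move=> a; rewrite [psi _]comp_lfunE phiE lker0_lfunK.
have phi_inj := can_inj phiK.
have phi1 : phi 1 = 1.
  by apply: L_inj; rewrite phiE rgenE R1 lgenE aact1.
have phiM a b : phi (a * b) = phi a * phi b.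
  apply: L_inj; rewrite phiE rgenE RM comp_lfunE -!rgenE -phiE.
  rewrite lgenE rgenE -comp_lfunE R_act comp_lfunE -rgenE -phiE lgenE.
  by rewrite lgenE aactM comp_lfunE.
exists psi; split.
- by exists phi.
- by apply: phi_inj; rewrite psiK.
- by move=> a b; apply: phi_inj; rewrite phiM !psiK.
suff E : (coact \o phi = (\1 ⊠ phi) \o (conj_coact gl A g))%VF.
  apply/lfunP => b; rewrite !comp_lfunE /= -{2}[b]psiK.
  have /lfunP/(_ (psi b)) := E; rewrite !comp_lfunE => ->.
  rewrite -[RHS]comp_lfunE -tmap_comp comp_lfun1l.
  have -> : (psi \o phi)%VF = \1%VF.
    by apply/lfunP => a; rewrite comp_lfunE phiK id_lfunE.
  by rewrite tmap_id id_lfunE.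
apply/lfunP => a; rewrite [LHS]comp_lfunE [RHS]comp_lfunE [conj_coact _ _ _ _]comp_lfunE.
rewrite -[RHS]comp_lfunE -tmap_comp comp_lfun1l comp_lfun1r.
(* Computing the coaction of phi(a) x = x a in both ways gives phi(a)_(-1) g (x) phi(a)_(0) x = g
   a_(-1) (x) x a_(0). It remains to cancel g on the right and to apply L^-1. *)
have := d_lgen (phi a) dx; rewrite phiE (d_rgen _ dx).
move/(congr1 (amulr (gl g^-1%g) ⊠ L^-1)%VF).
rewrite -!(comp_lfunE (_ ⊠ _)%VF) -!tmap_comp.
have -> : (L^-1 \o lgen x = \1)%VF.
  by apply/lfunP => b; rewrite comp_lfunE lker0_lfunK // id_lfunE.
have -> : (amulr (gl g^-1%g) \o amulr (gl g) = \1)%VF.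
  apply/lfunP => h; rewrite comp_lfunE !amulrE -mulrA -glikeM mulgV glike1.
  by rewrite mulr1 id_lfunE.
rewrite tmap_id id_lfunE => <-.
rewrite [RHS]comp_lfunE; congr ((_ ⊠ _)%VF _); apply/lfunP => h.
by rewrite comp_lfunE amullE amulrE adgE.
Qed.

End Bimodule.

(** * Equivalences are full and faithful *)

Section Equivalences.
Variable k : fieldType.

Lemma iso_cancel (C : linCat k) (X Y Z : C) (e : mor Y Z) (f g : mor X Y) :
  is_iso e -> e ∘ f = e ∘ g -> f = g.
Proof.
by move=> [e' [e'e _]] /(congr1 (cmp e')); rewrite !cmpA e'e !cmp1m.
Qed.

Lemma iso_cancelr (C : linCat k) (X Y Z : C) (e : mor X Y) (f g : mor Y Z) :
  is_iso e -> f ∘ e = g ∘ e -> f = g.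
Proof.
by move=> [e' [_ ee']] /(congr1 (cmp^~ e')); rewrite -!cmpA ee' !cmpm1.
Qed.

(** The preimage of [g] is eta_Y^-1 o Q g o eta_X. Naturality of eta shows that Q F sends it to Q g,
    and Q is faithful because eps is a natural isomorphism. *)
Lemma equivalence_full (C D : linCat k) (F : functor C D) : is_equivalence F ->
  forall X Y (g : mor (F X) (F Y)), exists f : mor X Y, fmor F f = g.
Proof.
move=> [Q [eta [eps [eta_iso eta_nat eps_iso eps_nat]]]] X Y g.
have Q_inj (Z W : D) (u v : mor Z W) : fmor Q u = fmor Q v -> u = v.
  move=> /(congr1 (fmor F))/(congr1 (cmp (eps W))).
  by rewrite !eps_nat; apply: iso_cancelr.
have [e [eY Ye]] := eta_iso Y.
exists (e ∘ fmor Q g ∘ eta X); apply: Q_inj.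
apply: (iso_cancelr (eta_iso X)); rewrite -eta_nat.
by rewrite -cmpA cmpA Ye cmp1m.
Qed.

Lemma equivalence_faithful (C D : linCat k) (F : functor C D) : is_equivalence F ->
  forall X Y, injective (@fmor _ _ _ F X Y).
Proof.
move=> [Q [eta [eps [eta_iso eta_nat _ _]]]] X Y f g fg.
by apply: (iso_cancel (eta_iso Y)); rewrite !eta_nat fg.
Qed.

Lemma fmorD (C D : linCat k) (F : functor C D) (X Y : C) (f g : mor X Y) :
  fmor F (f + g) = fmor F f + fmor F g.
Proof. by have := fmor_lin F 1 f g; rewrite !scale1r. Qed.

Lemma fmor0 (C D : linCat k) (F : functor C D) (X Y : C) :
  fmor F (0 : mor X Y) = 0.
Proof. by apply: (addrI (fmor F 0)); rewrite -fmorD !addr0. Qed.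

End Equivalences.

(** * Transport of a coaction along a module functor *)

Section TransportedCoaction.
Variables (k : fieldType) (C : tensorCat k) (M N : moduleCat C).
Variables (F : moduleFunctor M N) (X : C) (P : M) (l : mor P (mprod M X P)).

(** Used with [X] the regular module of H, a coalgebra in Rep(H), and [l] the coaction of A on its
    regular module. *)
Definition transport_coact : mor (F P) (mprod N X (F P)) :=
  mfc F X P ∘ fmor F l.

(** Naturality of [mfc] moves [D] and [l] through F, and [mfc_ass] exchanges the two associators;
    what is left is F applied to the hypothesis. *)
Lemma transport_assoc (D : mor X (tprod C X X)) :
  mass M X X P ∘ bmor (mprod M) D (Defs.idm P) ∘ l =
    bmor (mprod M) (Defs.idm X) l ∘ l ->
  mass N X X (F P) ∘ bmor (mprod N) D (Defs.idm (F P)) ∘ transport_coact =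
    bmor (mprod N) (Defs.idm X) transport_coact ∘ transport_coact.
Proof.
move=> e; rewrite /transport_coact -cmpA [X in _ ∘ X]cmpA -fmor1 -mfc_nat.
rewrite -(cmpA (mfc F _ _)) cmpA -mfc_ass -!cmpA -!fmor_cmp.
rewrite (cmpA (mass M _ _ _)) e fmor_cmp (cmpA (mfc F _ _)) mfc_nat.
by rewrite -[in RHS](cmp1m (Defs.idm X)) bmor_cmp !cmpA.
Qed.

Lemma transport_counit (e : mor X (tunit C)) :
  mlu M P ∘ bmor (mprod M) e (Defs.idm P) ∘ l = Defs.idm P ->
  mlu N (F P) ∘ bmor (mprod N) e (Defs.idm (F P)) ∘ transport_coact =
    Defs.idm (F P).
Proof.
move=> el; rewrite /transport_coact -cmpA [X in _ ∘ X]cmpA -fmor1 -mfc_nat.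
by rewrite -(cmpA (mfc F _ _)) cmpA mfc_unit -!fmor_cmp (cmpA (mlu M _)) el fmor1.
Qed.

End TransportedCoaction.

(** * Right multiplications and the coaction as module maps *)

Section RightMultiplication.
Variables (k : fieldType).

Section FAlg.
Variable A : falgType k.

Lemma rmul_proof (a b : A) :
  (amulr a \o aact (areg A) b = aact (areg A) b \o amulr a)%VF.
Proof.
by apply/lfunP => c; rewrite !comp_lfunE !amulrE !areg_mulE mulrA.
Qed.

Definition rmul (a : A) : amor (areg A) (areg A) :=
  @mk_amor k A (areg A) (areg A) (amulr a) (rmul_proof a).

End FAlg.

Variables (H : hopfAlg k) (A : comodAlg H).

Lemma ptens_areg (s t : tens H A) : ptens (areg H) (areg A) s t = tmul s t.
Proof.
move: s t.
apply: (@tens_ind2 _ _ _ _ _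
  (fun s t => ptens (areg H) (areg A) s t = tmul s t))
  => [t|s|s s' t h h'|s t t' h h'|h a h' a'].
- by rewrite linear0 zero_lfunE (bilin0l (@tmul_bilin _ _ _)).
- by rewrite linear0 (bilin0r (@tmul_bilin _ _ _)).
- by rewrite linearD add_lfunE h h' (bilinDl (@tmul_bilin _ _ _)).
- by rewrite linearD /= h h' (bilinDr (@tmul_bilin _ _ _)).
by rewrite ptensE tmapE !areg_mulE tmulE.
Qed.

(** Multiplicativity of the coaction is its A-linearity as a map A -> H (x) A, so module functors
    can be applied to it. *)
Lemma coact_mor_proof (a : A) :
  (coact \o aact (areg A) a = aact (atens (areg H) (areg A)) a \o coact)%VF.
Proof.
apply/lfunP => b; rewrite [LHS]comp_lfunE [RHS]comp_lfunE areg_mulE coactM -ptens_areg.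
by rewrite atens_actE.
Qed.

Definition coact_mor : amor (areg A) (atens (areg H) (areg A)) :=
  @mk_amor k A (areg A) (atens (areg H) (areg A)) coact coact_mor_proof.

End RightMultiplication.

(** * The bimodule attached to a module functor *)

Section Forward.
Variables (k : fieldType) (H : hopfAlg k) (A B : comodAlg H).
Variables (F : moduleFunctor (modRep A) (modRep B)).

Definition fbim : amod B := F (areg A).

Definition fR (a : A) : 'End(fbim) :=
  vsval (fmor F (rmul a) : amor fbim fbim).

Definition fcoact_mor : amor fbim (atens (areg H) fbim) :=
  @transport_coact k (Rep H) (modRep A) (modRep B) F (areg H) (areg A)
    (coact_mor A).

Definition fcoact : 'Hom(fbim, tens H fbim) := vsval fcoact_mor.

Lemma fR_linear : linear fR.
Proof.
move=> c a b; rewrite /fR.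
have -> : rmul (c *: a + b) = c *: rmul a + rmul b.
  by apply: amor_inj; rewrite /= linearP.
by rewrite (@fmor_lin _ _ _ F).
Qed.

Lemma fR1 : fR 1 = \1%VF.
Proof.
rewrite /fR; have -> : rmul 1 = amor_id (areg A).
  by apply: amor_inj; apply/lfunP => a; rewrite /= amulrE mulr1 id_lfunE.
exact: (congr1 vsval (fmor1 F (areg A))).
Qed.

Lemma fRM a b : fR (a * b) = (fR b \o fR a)%VF.
Proof.
rewrite /fR; have -> : rmul (a * b) = amor_cmp (rmul b) (rmul a).
  by apply: amor_inj; apply/lfunP => c; rewrite /= comp_lfunE !amulrE mulrA.
exact: (congr1 vsval (fmor_cmp F (rmul b) (rmul a))).
Qed.

Lemma fR_act a b : (fR a \o aact fbim b = aact fbim b \o fR a)%VF.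
Proof. exact: amorP. Qed.

(** F is full, and an A-linear endomorphism of A is right multiplication by its value at 1. *)
Lemma fR_full : is_equivalence F -> forall f : 'End(fbim),
  (forall b, (f \o aact fbim b = aact fbim b \o f)%VF) -> exists a, f = fR a.
Proof.
move=> eqF f fb; pose f' : amor fbim fbim := @mk_amor k B fbim fbim f fb.
have [h Fh] := equivalence_full eqF (f' : mor (F (areg A)) (F (areg A))).
exists (vsval h 1); rewrite /fR.
have -> : rmul (vsval h 1) = h.
  apply: amor_inj; apply/lfunP => a; rewrite /= amulrE.
  have /lfunP/(_ 1) := amorP (h : amor (areg A) (areg A)) a.
  by rewrite [LHS]comp_lfunE [RHS]comp_lfunE !areg_mulE mulr1.
by rewrite Fh.
Qed.

Lemma fbim_neq0 : is_equivalence F -> exists x : fbim, x != 0.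
Proof.
move=> eqF; apply: NNPP => h.
have fbim0 (x : fbim) : x = 0.
  by apply/eqP; apply: contra_notT h => x0; exists x.
have : rmul 1 = rmul (0 : A).
  apply: (equivalence_faithful eqF); apply: amor_inj; apply/lfunP => x.
  by rewrite [LHS]fbim0 [RHS]fbim0.
move=> e; have : vsval (rmul (1 : A)) 1 = vsval (rmul (0 : A)) 1 by rewrite e.
by rewrite /= !amulrE mulr1 mulr0 => /eqP; rewrite oner_eq0.
Qed.

Lemma fcoact_act b x :
  fcoact (aact fbim b x) = ptens (areg H) fbim (coact b) (fcoact x).
Proof.
have /lfunP/(_ x) := amorP fcoact_mor b.
by rewrite [LHS]comp_lfunE [RHS]comp_lfunE atens_actE.
Qed.

Let HA : amod A := atens (areg H) (areg A).
Let fHA : amod B := F HA.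
Let fc : amor fHA (atens (areg H) fbim) := mfc F (areg H) (areg A).
Let fEnd (m : amor HA HA) : amor fHA fHA := fmor F m.

(** Right multiplication by [t] on H (x) A is A-linear, and its image under F is computed through
    [mfc]. For a pure tensor this is naturality of [mfc]; both properties are additive in [t], which
    covers the values of the coaction. *)
Let tmul_mor (t : tens H A) : exists m : amor HA HA,
  (forall s, vsval m s = tmul s t) /\
  forall y, vsval fc (vsval (fEnd m) y) =
    tlift (fun h a => @amulr k H h ⊠ fR a) t (vsval fc y).
Proof.
elim/tens_ind: t => [|s t [m [mE FmE]] [m' [m'E Fm'E]]|h a].
- exists 0; split=> [s|y].
    by rewrite zero_lfunE (bilin0r (@tmul_bilin _ _ _)).
  have -> : fEnd 0 = 0 := fmor0 F HA HA.
  by rewrite zero_lfunE !linear0 zero_lfunE.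
- exists (m + m'); split=> [r|y].
    by rewrite add_lfunE mE m'E (bilinDr (@tmul_bilin _ _ _)).
  have -> : fEnd (m + m') = fEnd m + fEnd m' := fmorD F m m'.
  by rewrite add_lfunE !linearD add_lfunE /= FmE Fm'E.
exists (atens_mor (rmul h) (rmul a)); split=> [s|y].
  rewrite -[LHS]/((amulr h ⊠ amulr a)%VF s).
  elim/tens_ind: s => [|s s' hs hs'|u v].
  - by rewrite linear0 (bilin0l (@tmul_bilin _ _ _)).
  - by rewrite linearD /= hs hs' (bilinDl (@tmul_bilin _ _ _)).
  by rewrite tmapE tmulE !amulrE.
have := congr1 (fun f : amor _ (atens (areg H) fbim) => vsval f y)
  (mfc_nat F (rmul h : mor (areg H : Rep H) (areg H)) (rmul a)).
rewrite /= [LHS]comp_lfunE [RHS]comp_lfunE => ->.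
rewrite (tliftE (f := fun h a => amulr h ⊠ fR a)) //.
split=> [v c u w|u c v w]; rewrite ?fR_linear ?linearP /=;
  by rewrite ?(proj1 (@tmap_bilin _ _ _ _ _)) ?(proj2 (@tmap_bilin _ _ _ _ _)).
Qed.

(** In A, multiplying by [a] and then coacting is coacting and then multiplying by [coact a]; F is
    applied to this identity of morphisms. *)
Lemma fcoact_R a x : fcoact (fR a x) =
  tlift (fun h b => @amulr k H h ⊠ fR b) (coact a) (fcoact x).
Proof.
have [m [mE FmE]] := tmul_mor (coact a).
have e : amor_cmp (coact_mor A) (rmul a) = amor_cmp m (coact_mor A).
  apply: amor_inj; apply/lfunP => b; rewrite /= [LHS]comp_lfunE [RHS]comp_lfunE.
  by rewrite mE amulrE coactM.
have fcE y : fcoact y = vsval fc (vsval (fmor F (coact_mor A) : amor fbim fHA) y).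
  exact: comp_lfunE.
rewrite !fcE -FmE; congr (vsval fc _).
have := congr1 (fun f => vsval (fmor F f : amor fbim fHA) x) e.
by rewrite !(fmor_cmp F) /= [LHS]comp_lfunE [RHS]comp_lfunE.
Qed.

Lemma tlun_tmap (U W : vectType k) (e : 'Hom(U, (k^o : vectType k))) (t : tens U W) :
  tlun W ((e ⊠ \1)%VF t) = lslice W e t.
Proof.
elim/tens_ind: t => [|s t hs ht|u v]; first by rewrite !linear0.
  by rewrite !linearD /= hs ht.
by rewrite tmapE tlunE lsliceE id_lfunE.
Qed.

Lemma counit_mor_proof (h : H) :
  (hcounit \o aact (areg H) h = aact (triv H) h \o hcounit)%VF.
Proof.
apply/lfunP => x; rewrite [LHS]comp_lfunE [RHS]comp_lfunE areg_mulE hcounitM.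
by rewrite /= triv_actE scale_lfunE id_lfunE.
Qed.

Definition counit_mor : amor (areg H) (triv H) :=
  @mk_amor k H (areg H) (triv H) hcounit counit_mor_proof.

Lemma fcoact_counit x : lslice fbim hcounit (fcoact x) = x.
Proof.
have e0 : amor_cmp (amor_cmp (amlu (areg A))
    (atens_mor counit_mor (amor_id (areg A)))) (coact_mor A) = amor_id (areg A).
  apply: amor_inj; apply/lfunP => a; rewrite /= [LHS]comp_lfunE.
  rewrite [(_ \o _)%VF (coact a)]comp_lfunE tlun_tmap id_lfunE.
  exact: coact_counit.
have := @transport_counit k (Rep H) (modRep A) (modRep B) F (areg H) (areg A)
  (coact_mor A) counit_mor e0.
move=> /(congr1 (fun f : amor fbim fbim => vsval f x)).
rewrite /= [LHS]comp_lfunE [(_ \o _)%VF _]comp_lfunE tlun_tmap id_lfunE.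
exact.
Qed.

Lemma fcoact_assoc :
  (tassoc \o (hcomul ⊠ \1) \o fcoact = (\1 ⊠ fcoact) \o fcoact)%VF.
Proof.
have e0 : amor_cmp (amor_cmp (amass (areg H) (areg H) (areg A))
    (atens_mor (coact_mor (regular_comodAlg H)) (amor_id (areg A)))) (coact_mor A)
  = amor_cmp (atens_mor (amor_id (areg H)) (coact_mor A)) (coact_mor A).
  by apply: amor_inj; exact: coact_assoc.
have := @transport_assoc k (Rep H) (modRep A) (modRep B) F (areg H) (areg A)
  (coact_mor A) (coact_mor (regular_comodAlg H)) e0.
by move=> /(congr1 (fun f : amor fbim (atens (areg H) (atens (areg H) fbim)) => vsval f)).
Qed.

End Forward.

(** * Restriction along algebra isomorphisms *)

Section Restriction.
Variables (k : fieldType) (A B : falgType k) (f : 'Hom(B, A)).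
Hypotheses (f1 : f 1 = 1) (fM : forall a b, f (a * b) = f a * f b).

Section Object.
Variable M : amod A.

Lemma res_act1 : (aact M \o f)%VF 1 = \1%VF.
Proof. by rewrite comp_lfunE f1 aact1. Qed.
Lemma res_actM a b :
  (aact M \o f)%VF (a * b) = ((aact M \o f)%VF a \o (aact M \o f)%VF b)%VF.
Proof. by rewrite !comp_lfunE fM aactM. Qed.
Definition res : amod B := AMod res_act1 res_actM.

Lemma res_actE b : aact res b = aact M (f b).
Proof. exact: comp_lfunE. Qed.
End Object.

Lemma res_mor_proof (M N : amod A) (u : amor M N) b :
  (vsval u \o aact (res M) b = aact (res N) b \o vsval u)%VF.
Proof. by rewrite !res_actE; exact: (amorP u (f b)). Qed.
Definition res_mor (M N : amod A) (u : amor M N) : amor (res M) (res N) :=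
  @mk_amor k B (res M) (res N) (vsval u) (res_mor_proof u).

Lemma res_mor1 (M : amod A) : res_mor (amor_id M) = amor_id (res M).
Proof. exact: amor_inj. Qed.
Lemma res_mor_cmp (M N P : amod A) (v : amor N P) (u : amor M N) :
  res_mor (amor_cmp v u) = amor_cmp (res_mor v) (res_mor u).
Proof. exact: amor_inj. Qed.
Lemma res_mor_lin (M N : amod A) : linear (@res_mor M N).
Proof. by move=> c u v; apply: amor_inj. Qed.

Definition res_functor : functor (amodCat A) (amodCat B) :=
  @Functor k (amodCat A) (amodCat B) res res_mor res_mor1 res_mor_cmp
    res_mor_lin.

End Restriction.

Section RestrictionEquivalence.
Variables (k : fieldType) (A B : falgType k).
Variables (f : 'Hom(B, A)) (h : 'Hom(A, B)).
Hypotheses (f1 : f 1 = 1) (fM : forall a b, f (a * b) = f a * f b).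
Hypotheses (h1 : h 1 = 1) (hM : forall a b, h (a * b) = h a * h b).

Lemma res_id_proof (M : amod A) : cancel h f -> forall a,
  (\1 \o aact M a = aact (res h1 hM (res f1 fM M)) a \o \1)%VF.
Proof. by move=> hK a; rewrite comp_lfun1l comp_lfun1r !res_actE hK. Qed.

Lemma res_id_inv_proof (M : amod A) : cancel h f -> forall a,
  (\1 \o aact (res h1 hM (res f1 fM M)) a = aact M a \o \1)%VF.
Proof. by move=> hK a; rewrite comp_lfun1l comp_lfun1r !res_actE hK. Qed.
End RestrictionEquivalence.

Lemma res_equivalence (k : fieldType) (A B : falgType k)
    (f : 'Hom(B, A)) (h : 'Hom(A, B)) (f1 : f 1 = 1)
    (fM : forall a b, f (a * b) = f a * f b) :
  cancel f h -> cancel h f -> is_equivalence (res_functor f1 fM).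
Proof.
move=> fK hK.
have h1 : h 1 = 1 by rewrite -f1 fK.
have hM a b : h (a * b) = h a * h b by rewrite -{1}[a]hK -{1}[b]hK -fM fK.
exists (res_functor h1 hM).
exists (fun M => @mk_amor k A M (res h1 hM (res f1 fM M)) \1%VF
   (res_id_proof f1 fM h1 hM M hK)).
exists (fun N => @mk_amor k B (res f1 fM (res h1 hM N)) N \1%VF
   (res_id_inv_proof h1 hM f1 fM N fK)).
split=> [M|M M' u|N|N N' u].
- exists (@mk_amor k A (res h1 hM (res f1 fM M)) M \1%VF
   (res_id_inv_proof f1 fM h1 hM M hK)).
  by split; apply: amor_inj; rewrite /= comp_lfun1l.
- by apply: amor_inj; rewrite /= comp_lfun1l comp_lfun1r.
- exists (@mk_amor k B N (res f1 fM (res h1 hM N)) \1%VF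
   (res_id_proof h1 hM f1 fM N fK)).
  by split; apply: amor_inj; rewrite /= comp_lfun1l.
- by apply: amor_inj; rewrite /= comp_lfun1l comp_lfun1r.
Qed.

(** * From a conjugation isomorphism to a module equivalence *)

Section Backward.
Variables (k : fieldType) (G : finGroupType) (H : hopfAlg k).
Variables (gl : grouplikes G H) (A B : comodAlg H) (g : G).
Variable f : 'Hom(B, A).
Hypotheses (f1 : f 1 = 1) (fM : forall a b, f (a * b) = f a * f b).
Hypothesis f_coact : (conj_coact gl A g \o f = (\1 ⊠ f) \o coact)%VF.

(** On the left b acts by f(b)_(-1) (x) f(b)_(0), on the right by g f(b)_(-1) g^-1 (x) f(b)_(0)
    according to [f_coact]; the action of g on [X] intertwines the two. *)
Lemma twist_proof (X : amod H) (M : amod A) b :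
  ((aact X (gl g) ⊠ \1) \o aact (res f1 fM (atens X M)) b =
   aact (atens X (res f1 fM M)) b \o (aact X (gl g) ⊠ \1))%VF.
Proof.
have resE s : ptens X (res f1 fM M) s = ptens X M ((\1 ⊠ f)%VF s).
  elim/tens_ind: s => [|s t hs ht|h a]; first by rewrite !linear0.
    by rewrite !linearD /= hs ht.
  by rewrite tmapE !ptensE res_actE id_lfunE.
rewrite res_actE !atens_actE resE.
have /lfunP/(_ b) := f_coact; rewrite [LHS]comp_lfunE [RHS]comp_lfunE => <-.
rewrite [conj_coact gl A g _]comp_lfunE.
elim/tens_ind: (coact (f b)) => [|s t hs ht|h a].
- by rewrite !linear0 comp_lfun0l comp_lfun0r.
- by rewrite !linearD /= comp_lfunDl comp_lfunDr hs ht.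
rewrite tmapE !ptensE -!tmap_comp id_lfunE comp_lfun1l comp_lfun1r adgE.
by rewrite -!aactM -!mulrA glVg mulr1.
Qed.

Definition twist (X : amod H) (M : amod A) :
    amor (res f1 fM (atens X M)) (atens X (res f1 fM M)) :=
  @mk_amor k B (res f1 fM (atens X M)) (atens X (res f1 fM M))
    (aact X (gl g) ⊠ \1)%VF (twist_proof X M).

Lemma aact_gl (X : amod H) x y : (x * y = 1)%g ->
  (aact X (gl x) \o aact X (gl y))%VF = \1%VF.
Proof. by move=> e; rewrite -aactM -glikeM e glike1 aact1. Qed.

Lemma twist_iso (X : amod H) (M : amod A) :
  @is_iso k (amodCat B) _ _ (twist X M).
Proof.
have VK : ((aact X (gl g) ⊠ \1) \o (aact X (gl g^-1%g) ⊠ \1))%VF =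
    \1%VF :> 'End(tens X M).
  by rewrite -tmap_comp aact_gl ?mulgV // comp_lfun1l tmap_id.
have KV : ((aact X (gl g^-1%g) ⊠ \1) \o (aact X (gl g) ⊠ \1))%VF =
    \1%VF :> 'End(tens X M).
  by rewrite -tmap_comp aact_gl ?mulVg // comp_lfun1l tmap_id.
exists (@mk_amor k B (atens X (res f1 fM M)) (res f1 fM (atens X M)) _
  (intertwine_inv (M := res f1 fM (atens X M)) (N := atens X (res f1 fM M))
    VK KV (twist_proof X M))).
by split; apply: amor_inj; rewrite /= ?VK ?KV.
Qed.

Lemma twist_nat (X X' : amod H) (M M' : amod A) (u : amor X X')
    (v : amor M M') :
  amor_cmp (twist X' M') (res_mor f1 fM (atens_mor u v)) =
  amor_cmp (atens_mor u (res_mor f1 fM v)) (twist X M).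
Proof.
by apply: amor_inj; rewrite /= -!tmap_comp comp_lfun1l comp_lfun1r amorP.
Qed.

(** As g is grouplike, it acts on X (x) Y by g (x) g. *)
Lemma twist_ass (X Y : amod H) (M : amod A) :
  amor_cmp (amor_cmp (atens_mor (amor_id X) (twist Y M)) (twist X (atens Y M)))
    (res_mor f1 fM (amass X Y M)) =
  amor_cmp (amass X Y (res f1 fM M)) (twist (rtens X Y) M).
Proof.
apply: amor_inj; rewrite /=.
have -> : atens_act (A := regular_comodAlg H) X Y (gl g) =
    (aact X (gl g) ⊠ aact Y (gl g))%VF.
  by rewrite comp_lfunE /= glike_comul (@ptensE _ _ (regular_comodAlg H)).
by rewrite -tmap_comp comp_lfun1l comp_lfun1r -tassoc_nat.
Qed.

Lemma twist_unit (M : amod A) :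
  amor_cmp (amlu (res f1 fM M)) (twist (triv H) M) = res_mor f1 fM (amlu M).
Proof.
apply: amor_inj; rewrite /= triv_actE glike_counit scale1r tmap_id.
exact: comp_lfun1r.
Qed.

Definition twist_functor : moduleFunctor (modRep A) (modRep B) :=
  @ModuleFunctor k (Rep H) (modRep A) (modRep B) (res_functor f1 fM)
    twist twist_iso twist_nat twist_ass twist_unit.

End Backward.

Lemma conj_module_equivalent (k : fieldType) (G : finGroupType) (H : hopfAlg k)
    (gl : grouplikes G H) (A B : comodAlg H) (g : G) :
  comodAlg_iso B (conj_comodAlg gl A g) ->
  module_equivalent (modRep A) (modRep B).
Proof.
move=> [f [[h fK hK] f1 fM fc]]; exists (@twist_functor k G H gl A B g f f1 fM fc).
(* [bijective] provides only an inverse function, which must be turned into a linear map. *)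
have hl : linear h.
  by move=> c u v; apply: (can_inj fK); rewrite linearP /= !hK.
apply: (@res_equivalence k A B f (linfun h)) => x; by rewrite linfunE.
Qed.

Theorem theorem4p2
  (k : closedFieldType) (char0 : [pchar k] =i pred0)
  (Gamma : finGroupType) (H : hopfAlg k) (gl : grouplikes Gamma H)
  (H_pointed : pointed H) (H_coradical : is_coradical (glspan gl))
  (V : vectType k) (YV : ydStruct Gamma V)
  (BV : braidedHopf k Gamma) (gr : nat -> {vspace BV})
  (BV_Nichols : is_Nichols YV gr)
  (p : nat -> 'Hom(H, smash BV)) (grH : gr_hopf_iso gl gr p)
  (A A' : comodAlg H) (A_simple : right_simple A) (A'_simple : right_simple A')
  (F F' : {group Gamma}) (psi psi' : Gamma -> Gamma -> k)
  (psi_cocycle : cocycle2 F psi) (psi'_cocycle : cocycle2 F' psi')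
  (A0 : loewy0_iso gl A F psi) (A'0 : loewy0_iso gl A' F' psi')
  (K K' : {vspace BV})
  (K_coideal : homog_left_coideal_subalg gr K)
  (K'_coideal : homog_left_coideal_subalg gr K')
  (K_stable : act_stable F K) (K'_stable : act_stable F' K')
  (grA : exists s, gr_comod_iso gl gr (A := A) F psi p K s)
  (grA' : exists s, gr_comod_iso gl gr (A := A') F' psi' p K' s) :
  module_equivalent (modRep A) (modRep A') <->
  exists g : Gamma, comodAlg_iso A' (conj_comodAlg gl A g).
Proof.
split=> [[Fm eqF]|[g iso_g]]; last exact: conj_module_equivalent iso_g.
(* The degree-zero component of gr H = B(V) # k Gamma sends h in Gamma to 1 # h. The counit of its
   g-component thus gives functionals dual to the group elements. *)
pose chi g : 'Hom(H, k^o : vectType k) :=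
  linfun (fun x => bcounit (p 0%N x g) : k^o).
have chiE g h : chi g (gl h) = (g == h)%:R.
  rewrite linfunE => [|c x y]; last by rewrite linearP !ffunE linearP.
  rewrite (grH_group grH) smash_pureE ffunE.
  by case: eqP => _; rewrite ?bcounit1 ?linear0.
have gl_in_sub := grouplike_in_subcoalgebra chiE H_pointed H_coradical.
have RE := linfunE (@fR_linear _ _ _ _ Fm).
apply: (@bimodule_conj _ _ _ _ gl_in_sub _ _ A_simple _ (fbim Fm) (fcoact Fm)
  (linfun (@fR _ _ _ _ Fm))).
- by move=> J; apply: (loewy0_left_simple gl_in_sub psi'_cocycle A'0).
- exact: fbim_neq0.
- exact: fcoact_assoc.
- exact: fcoact_counit.
- exact: fcoact_act.
- by rewrite RE fR1.
- by move=> a b; rewrite !RE fRM.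
- by move=> a b; rewrite RE fR_act.
- move=> a x; rewrite RE fcoact_R !tlift_funE; congr (fun_of_lfun _ (fcoact Fm x)).
  by apply: eq_bigr => i _; apply: eq_bigr => j _; rewrite RE.
- by move=> f /(fR_full eqF)[a ->]; exists a; rewrite RE.
Qed.
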